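(* Let $\{\beta_n\}_n$ be a sequence of nonnegative reals with $\beta_n\gg n\log n$. Let $\{U_e\}_{e\in E(K_n)}$ be i.i.d. $\mathrm{Unif}[0,1]$, couple $\mathsf{WST}_n^{\beta_n}$ and $\mathsf{MST}_n$ by using the same labels, and let $o$ be a uniformly chosen vertex of $K_n$ (independent of the labels and the trees). Then for every fixed $r\in\mathbb N$, $$\mathbb E\left[\mathbb P\left(B_{\mathsf{MST}_n}(o,r)=B_{\mathsf{WST}_n^{\beta_n}}(o,r)\ \middle|\ \{U_e\}_{e\in E(K_n)}\right)\right]\to1\quad\text{as } n\to\infty .$$ Consequently, the local limit of $\mathsf{WST}_n^{\beta_n}$ is the same as the local limit of $\mathsf{MST}_n$.
   Context: $K_n$ is the complete graph on $n$ vertices. $a_n\gg b_n$ means $\lim_{n\to\infty}b_n/a_n=0$. $B_T(o,r)$ denotes the ball of radius $r$ around $o$ (as a rooted subgraph) in the tree $T$ with respect to the unweighted graph metric. Given $\mathbf U=\{U_e\}$, $\mathsf{WST}_n^{\beta_n}$ is the random spanning tree of $K_n$ with $$\mathbb P(\mathsf{WST}_n^{\beta_n}=T\mid\mathbf U)=\frac{\exp(-\beta_n\sum_{e\in T}U_e)}{\sum_{T'}\exp(-\beta_n\sum_{e\in T'}U_e)},$$ the sum being over all spanning trees $T'$ of $K_n$; $\mathsf{MST}_n$ is the (a.s. unique) spanning tree $T$ of $K_n$ minimizing $\sum_{e\in T}U_e$. Local limit means the Benjamini--Schramm (local weak) limit: the limit in distribution of the tree rooted at a uniformly random vertex, i.e.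 a random rooted graph $(G,\rho)$ such that for each $r$ the law of the isomorphism class of the $r$-ball around the random root converges to that of the $r$-ball of $(G,\rho)$. It is known (Addario-Berry) that $\mathsf{MST}_n$ has a locally finite local limit. *)

(* Defs.v *)
From HB Require Import structures.
From mathcomp Require Import all_boot all_order all_algebra.
From mathcomp Require Import all_classical all_reals all_analysis.
From mathcomp Require Import measurable_realfun.

Set Implicit Arguments.
Unset Strict Implicit.
Unset Printing Implicit Defensive.

Import Order.TTheory GRing.Theory Num.Theory.
Import numFieldNormedType.Exports.

Local Open Scope classical_set_scope.
Local Open Scope ring_scope.

(* [a_n >> b_n]. The first conjunct is needed because division by zero is total:
   without it the zero sequence would dominate every sequence. *)
Definition much_greater (R : realType) (a b : nat -> R) : Prop :=
  (\forall n \near \oo, a n != 0) /\ (b n / a n @[n --> \oo] --> (0 : R)).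

Definition edge (n : nat) := {e : {set 'I_n} | #|e| == 2}.

Definition tadj (n : nat) (T : {set edge n}) : rel 'I_n :=
  fun x y => [exists e in T, val e == [set x; y]%SET].

Definition acyclic (n : nat) (T : {set edge n}) : Prop :=
  forall c : seq 'I_n, ~ [/\ (2 < size c)%N, uniq c & cycle (tadj T) c].

Definition spanning_tree (n : nat) (T : {set edge n}) : bool :=
  [forall x, forall y, connect (tadj T) x y] && `[< acyclic T >].

Definition total_label (R : realType) (n : nat) (u : edge n -> R)
  (T : {set edge n}) : R := \sum_(e in T) u e.

Definition is_mst (R : realType) (n : nat) (u : edge n -> R)
    (T : {set edge n}) : Prop :=
  spanning_tree T /\
  forall T', spanning_tree T' -> total_label u T <= total_label u T'.

Definition wst_law (R : realType) (n : nat) (beta : R) (u : edge n -> R)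
    (T : {set edge n}) : R :=
  expR (- beta * total_label u T) /
  \sum_(T' : {set edge n} | spanning_tree T') expR (- beta * total_label u T').

(* Only vertices in [rg_verts] count; [V] is an ambient type. *)
Record rooted_graph (V : Type) := RootedGraph {
  rg_verts : set V ;
  rg_adj : rel V ;
  rg_root : V }.

Definition rooted_tree (n : nat) (T : {set edge n}) (o : 'I_n) :
    rooted_graph 'I_n :=
  RootedGraph setT (tadj T) o.

Definition ball_verts (V : Type) (r : nat) (G : rooted_graph V) : set V :=
  [set x | exists p : seq V,
    [/\ path (rg_adj G) (rg_root G) p, last (rg_root G) p = x &
        (size p <= r)%N]].

Definition rooted_ball (V : Type) (r : nat) (G : rooted_graph V) :
    rooted_graph V :=
  RootedGraph (ball_verts r G)
    (fun x y => [&& x \in ball_verts r G, y \in ball_verts r G & rg_adj G x y])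
    (rg_root G).

Definition rooted_iso (V W : Type) (G : rooted_graph V)
    (H : rooted_graph W) : Prop :=
  exists f : V -> W,
    [/\ set_bij (rg_verts G) (rg_verts H) f,
        f (rg_root G) = rg_root H &
        forall x y, rg_verts G x -> rg_verts G y ->
          rg_adj H (f x) (f y) = rg_adj G x y].

Record connected_locally_finite (V : Type) (G : rooted_graph V) : Prop := {
  clf_root : rg_verts G (rg_root G) ;
  clf_verts : forall x y, rg_adj G x y -> rg_verts G x /\ rg_verts G y ;
  clf_sym : symmetric (rg_adj G) ;
  clf_irr : irreflexive (rg_adj G) ;
  clf_connected : forall x, rg_verts G x ->
    exists2 p, path (rg_adj G) (rg_root G) p & last (rg_root G) p = x ;
  clf_locally_finite : forall x, finite_set [set y | rg_adj G x y] }.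

(* A connected locally finite graph is countable, so that a random one can be
   realized with its vertex set in [nat]. *)
Record random_rooted_graph (d : measure_display) (T : measurableType d)
    (G : T -> rooted_graph nat) : Prop := {
  rrg_clf : forall w, connected_locally_finite (G w) ;
  rrg_measurable_verts : forall i, measurable [set w | rg_verts (G w) i] ;
  rrg_measurable_adj : forall i j, measurable [set w | rg_adj (G w) i j] ;
  rrg_measurable_root : forall i, measurable [set w | rg_root (G w) = i] }.

(* The law of the isomorphism class of an [r]-ball is a law on the countable
   set of classes of finite rooted graphs, where convergence in distribution to
   a probability law is convergence of the probability of every class; the
   classes are represented by the graphs on subsets of ['I_k]. *)
Definition local_limit (R : realType) (d : nat -> measure_display)
    (Omega : forall n, measurableType (d n))
    (P : forall n, probability (Omega n) R) (V : nat -> Type)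
    (G : forall n, Omega n -> rooted_graph (V n))
    (d' : measure_display) (Omega' : measurableType d')
    (P' : probability Omega' R) (G' : Omega' -> rooted_graph nat) : Prop :=
  forall (r k : nat) (H : rooted_graph 'I_k),
    P n [set w | rooted_iso (rooted_ball r (G n w)) H] @[n --> \oo] -->
    P' [set w | rooted_iso (rooted_ball r (G' w)) H].

Section probability_notions.
Context (R : realType) (d : measure_display) (Omega : measurableType d)
  (P : probability Omega R).

Definition mutually_independent (I : finType) (X : I -> {RV P >-> R}) : Prop :=
  forall (J : {set I}) (B : I -> set R), (forall i, measurable (B i)) ->
    P (\bigcap_(i in [set` J]) (X i @^-1` B i)) =
    (\prod_(i in J) P (X i @^-1` B i))%E.

Definition independent_systems (F G : set (set Omega)) : Prop :=
  forall A B, F A -> G B -> P (A `&` B) = (P A * P B)%E.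

Definition rv_system (I : Type) (X : I -> {RV P >-> R}) : set (set Omega) :=
  \bigcup_i preimage_set_system setT (X i) measurable.

(* For [X] with values in a finite type, endowed with all its subsets. *)
Definition discrete_system (F : finType) (X : Omega -> F) : set (set Omega) :=
  preimage_set_system setT X setT.

(* [Y] is a version of the conditional probability [P(E | G)], where [G] is a
   sub-sigma-algebra. *)
Definition is_cond_prob (G : set (set Omega)) (E : set Omega)
    (Y : Omega -> R) : Prop :=
  [/\ preimage_set_system setT Y measurable `<=` G,
      P.-integrable setT (EFin \o Y) &
      forall A, G A -> (\int[P]_(w in A) (Y w)%:E)%E = P (A `&` E)].

(* So a statement quantified over all versions is not vacuous. *)
Lemma cond_prob_exists (G : set (set Omega)) (E : set Omega) :
  <<s G >> `<=` measurable -> measurable E ->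
  exists Y : Omega -> R, is_cond_prob <<s G >> E Y.
Proof.
move=> Gm mE.
pose f : Omega -> g_sigma_algebraType G := id.
have mf : measurable_fun setT f by move=> _ A mA; rewrite setTI; exact: Gm.
pose mfm := isMeasurableFun.Build _ _ _ _ _ mf.
pose F : {mfun Omega >-> g_sigma_algebraType G} := HB.pack f mfm.
pose mu : probability (g_sigma_algebraType G) R := distribution P F.
have PE : (P E < +oo)%E by rewrite (le_lt_trans (probability_le1 P mE))// ltry.
pose nu0 : {finite_measure set Omega -> \bar R} := mfrestr mE PE.
pose restr (A : set (g_sigma_algebraType G)) := P (A `&` E).
have restr0 : restr set0 = 0%E by rewrite /restr set0I measure0.
have restr_fin A : measurable A -> restr A \is a fin_num.
  by move=> mA; apply: fin_num_measure; apply: measurableI => //; exact: Gm.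
have restr_additive : semi_sigma_additive restr.
  move=> A mA tA mbA; apply: (@measure_semi_sigma_additive _ _ _ nu0) => //.
  - by move=> k; apply: Gm; exact: mA.
  - by apply: Gm; exact: mbA.
pose nu : {charge set (g_sigma_algebraType G) -> \bar R} :=
  HB.pack restr (isCharge.Build _ _ _ restr restr0 restr_fin restr_additive).
have nuE A : nu A = P (A `&` E) by [].
have numu : nu `<< mu.
  apply/null_content_dominatesP => A mA /= muA0; apply/eqP.
  rewrite eq_le measure_ge0 andbT -[leRHS]muA0.
  apply: le_measure; rewrite ?inE//; last exact: Gm.
  by apply: measurableI => //; exact: Gm.
pose h : g_sigma_algebraType G -> \bar R := Radon_Nikodym nu mu.
have hfin x : h x \is a fin_num by exact: Radon_Nikodym_fin_num.
have hint : mu.-integrable setT h by exact: Radon_Nikodym_integrable.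
have mh := measurable_int _ hint.
have hP : P.-integrable setT (h \o f).
  apply/integrableP; split.
    by move=> _ B mB; rewrite setTI; apply: Gm; move: (mh measurableT B mB);
      rewrite setTI.
  move/integrableP : hint => [_]; rewrite ge0_integral_pushforward//.
  exact: measurableT_comp.
have EfineE : EFin \o (fine \o h) = h.
  by apply/funext => x /=; rewrite fineK.
exists (fine \o h); split.
- move=> _ [B mB <-]; rewrite setTI.
  have : measurable_fun setT (fine \o h).
    by apply/measurable_EFinP; rewrite EfineE.
  by move=> /(_ measurableT B mB); rewrite setTI.
- by rewrite EfineE.
- move=> A GA; rewrite -nuE (Radon_Nikodym_integral numu)//.
  rewrite integral_pushforward//; last first.
    by apply: integrableS hP => //; exact: Gm.
  by apply: eq_integral => x _ /=; rewrite fineK.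
Qed.

(* Labels [U], minimum spanning tree [M], Gibbs spanning tree [W] and root [o]
   on the complete graph with [n] vertices. *)
Record mst_wst_coupling (n : nat) (beta : R) (U : edge n -> {RV P >-> R})
    (M W : Omega -> {set edge n}) (o : Omega -> 'I_n) : Prop := {
  cpl_U_uniform : forall e (B : set R), measurable B ->
    distribution P (U e) B = uniform_prob (@ltr01 R) B ;
  cpl_U_independent : mutually_independent U ;
  cpl_M_measurable : discrete_system M `<=` measurable ;
  cpl_M_mst : {ae P, forall w, is_mst (fun e => U e w) (M w)} ;
  cpl_W_measurable : discrete_system W `<=` measurable ;
  cpl_W_tree : {ae P, forall w, spanning_tree (W w)} ;
  cpl_W_law : forall T : {set edge n}, spanning_tree T ->
    is_cond_prob <<s rv_system U >> [set w | W w = T]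
      (fun w => wst_law beta (fun e => U e w) T) ;
  cpl_o_measurable : discrete_system o `<=` measurable ;
  cpl_o_uniform : forall v, P [set w | o w = v] = (n%:R^-1)%:E ;
  cpl_o_independent : independent_systems
    <<s rv_system U `|` discrete_system M `|` discrete_system W >>
    (discrete_system o) }.

End probability_notions.

(* Main.v *)
(** An edge [e] lies outside the minimum spanning tree exactly when its label
    exceeds the threshold at which the other edges join its ends, and a swap of
    edges shows that the Gibbs tree avoids [e] once this excess is much larger
    than [log N / beta].  The threshold is independent of the label of [e], so an
    excess below [delta] has probability at most [delta]; as
    [log N / beta << 1 / N], the two trees differ in [o(N)] edges on average.

    To go from edges to balls, the neighbourhood in the minimum spanning tree of
    a set of [o(N)] vertices must again have [o(N)] vertices.  Tree edges with
    label at most [L / N] form a subgraph of a sparse random graph, whose degrees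
    have bounded second moment.  The tree edges with label above [q] number at
    most [1 / N] times the ordered pairs of vertices not joined at level [q],
    and each [e] satisfies [q * P (ends of e not joined by other edges at q) <=
    P (e is a tree edge)]; summing over [e] bounds their expected number by
    [4 N / L]. *)

Require Import Defs.
From mathcomp Require Import all_boot all_order all_algebra.
From mathcomp Require Import all_classical all_reals all_analysis.
From mathcomp Require Import measurable_realfun ring lra.

Set Implicit Arguments.
Unset Strict Implicit.
Unset Printing Implicit Defensive.

Import Order.TTheory GRing.Theory Num.Theory.
Import numFieldNormedType.Exports.

(** * Connectivity, bridges and edge exchange in spanning trees *)

Section spanning_trees.
Local Open Scope set_scope.
Variable n : nat.
Implicit Types (A B F T : {set edge n}) (e f g h : edge n) (x y z a b : 'I_n).

Definition joined A e :=
  [forall x in val e, forall y in val e, connect (tadj A) x y].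

Lemma tadj_sym A : symmetric (tadj A).
Proof. by move=> x y; apply: eq_existsb => e; rewrite finset.setUC. Qed.

Lemma connect_tadjC A : connect_sym (tadj A).
Proof. exact/sym_connect_sym/tadj_sym. Qed.

Lemma edge_ends e : exists x y, x != y /\ val e = [set x; y].
Proof. by case/cards2P: (valP e) => x [y]; exists x, y. Qed.

Lemma tadj_edge A e x y : val e = [set x; y] -> tadj A x y = (e \in A).
Proof.
move=> exy; apply/exists_inP/idP => [[f fA /eqP fxy]|eA].
  by rewrite (_ : e = f) //; apply: val_inj; rewrite exy.
by exists e => //; rewrite exy.
Qed.

Lemma joinedE A e x y : val e = [set x; y] ->
  joined A e = connect (tadj A) x y.
Proof.
move=> exy; apply/forall_inP/idP => [/(_ x)|xy u].
  rewrite exy set21 => /(_ isT)/forall_inP/(_ y); rewrite set22; exact.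
rewrite exy => ue; apply/forall_inP => v; move: ue.
by rewrite !inE => /orP[]/eqP-> /orP[]/eqP->; rewrite ?connect0 // connect_tadjC.
Qed.

Lemma in_joined A e : e \in A -> joined A e.
Proof.
have [x [y [_ exy]]] := edge_ends e => eA.
by rewrite (joinedE _ exy) connect1 // (tadj_edge _ exy).
Qed.

Lemma connect_joined A B x y : {in A, forall g, joined B g} ->
  connect (tadj A) x y -> connect (tadj B) x y.
Proof.
move=> AB; apply: connect_sub x y => x y /exists_inP[e eA /eqP exy].
by rewrite -(joinedE _ exy) AB.
Qed.

Lemma connect_tadjS A B x y : A \subset B ->
  connect (tadj A) x y -> connect (tadj B) x y.
Proof. by move=> /fintype.subsetP AB; apply: connect_joined => g /AB /in_joined. Qed.

Lemma joined_joined A B e : {in A, forall g, joined B g} ->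
  joined A e -> joined B e.
Proof.
have [x [y [_ exy]]] := edge_ends e.
by rewrite !(joinedE _ exy); exact: connect_joined.
Qed.

Lemma joinedS A B e : A \subset B -> joined A e -> joined B e.
Proof. by move=> /fintype.subsetP AB; apply: joined_joined => g /AB /in_joined. Qed.

(** A walk that uses [g] can be shortened to one that crosses [g] only once, in one of the two
    directions. *)
Lemma connectD1 A g a b x y : val g = [set a; b] -> connect (tadj A) x y ->
  [\/ connect (tadj (A :\ g)) x y,
      connect (tadj (A :\ g)) x a /\ connect (tadj (A :\ g)) b y |
      connect (tadj (A :\ g)) x b /\ connect (tadj (A :\ g)) a y].
Proof.
move=> gab /connectP[p]; elim: p x => [|z p IHp] x /= => [_ ->|].
  by apply: Or31.
case/andP=> /exists_inP[e eA /eqP exz] {}/IHp IHp /IHp {IHp}.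
have [eg|neg] := eqVneq e g; last first.
  have xz : connect (tadj (A :\ g)) x z.
    by rewrite connect1 // (tadj_edge _ exz) !inE neg.
  by case=> [|[]|[]] => *; [apply: Or31|apply: Or32|apply: Or33]; rewrite ?(connect_trans xz).
move: exz; rewrite eg gab => abxz.
have : (x \in [set a; b]) && (z \in [set a; b]) by rewrite abxz set21 set22.
have : (a \in [set x; z]) && (b \in [set x; z]) by rewrite -abxz set21 set22.
rewrite !inE => /andP[ax bx] /andP[xa za].
case/orP: xa => /eqP xa; subst x; case/orP: za => /eqP za; subst z;
  case=> [?|[? ?]|[? ?]];
  by [apply: Or31; rewrite ?connect0 | apply: Or32; rewrite ?connect0
     |apply: Or33; rewrite ?connect0 ].
Qed.

(** Trees are handled below through bridges instead of cycles. If the ends of [g] are joined without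
    [g], a path without repetition between them closes up with [g] to a cycle; conversely, the rest
    of a cycle bypasses its first edge. *)
Lemma spanning_treeP T :
  reflect ((forall x y, connect (tadj T) x y) /\
           {in T, forall g, ~~ joined (T :\ g) g})
          (spanning_tree T).
Proof.
apply: (iffP andP) => -[conT acT]; split.
- by move=> x y; move/forallP/(_ x)/forallP: conT; apply.
- move=> g gT; apply/negP; have [a [b [ab gab]]] := edge_ends g.
  rewrite (joinedE _ gab) => /connectP[p0 /shortenP[p p_path p_uniq _] bE].
  case: p p_path p_uniq bE => [|z [|t p]].
  + by move=> _ _ /= ba; rewrite ba eqxx in ab.
  + move=> /= + _ bz; rewrite -bz andbT => /exists_inP[e].
    rewrite !inE => /andP[/eqP eg _] /eqP eab; apply: eg.
    by apply: val_inj; rewrite eab gab.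
  + move=> p_path p_uniq bE; move/asboolP: acT => /(_ [:: a, z, t & p]); apply; split=> //.
    rewrite /cycle rcons_path -bE; apply/andP; split.
      apply: sub_path p_path => u v /exists_inP[e]; rewrite !inE => /andP[_ eT] euv.
      by apply/exists_inP; exists e.
    by rewrite tadj_sym (tadj_edge _ gab).
- by apply/forallP => x; apply/forallP.
- apply/asboolP => -[|x [|y [|z s]]] [] //= _.
  rewrite !inE !negb_or => /and4P[/and3P[xy xz xs] /andP[yz ys] _ _].
  case/and3P => xyT yzT zp.
  have /exists_inP[g gT /eqP gxy] := xyT.
  have /negP := acT _ gT; apply; rewrite (joinedE _ gxy) connect_tadjC.
  (* A step leaving a vertex other than [x] and [y] cannot use [g], so the cycle minus its first
     edge leads from [y] around to [x] in [T :\ g]. *)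
  have away u v : u != x -> u != y -> tadj T u v -> tadj (T :\ g) u v.
    move=> ux uy /exists_inP[e eT /eqP euv]; apply/exists_inP; exists e; last by rewrite euv.
    rewrite !inE eT andbT; apply/eqP => eg; move: (set21 u v).
    by rewrite -euv eg gxy !inE (negPf ux) (negPf uy).
  apply: (@connect_trans _ _ z).
    by rewrite connect_tadjC; apply: connect1; rewrite away 1?eq_sym// tadj_sym.
  have zx : z != x by rewrite eq_sym.
  have zy : z != y by rewrite eq_sym.
  elim: s z zx zy zp xs ys {xz yz yzT} => [|t s IHs] z zx zy /=.
    by rewrite andbT => zp _ _; rewrite connect1 // away.
  rewrite !inE !negb_or => /andP[zt tp] /andP[xt xs] /andP[yt ys].
  apply: (@connect_trans _ _ t); first by rewrite connect1 // away.
  by apply: IHs => //; rewrite eq_sym.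
Qed.

Lemma joined_total T : (forall x y, connect (tadj T) x y) -> forall e, joined T e.
Proof.
by move=> conT e; have [x [y [_ exy]]] := edge_ends e; rewrite (joinedE _ exy).
Qed.

Lemma connect_tree T x y : spanning_tree T -> connect (tadj T) x y.
Proof. by case/spanning_treeP. Qed.

Lemma tree_joinedN T g : spanning_tree T -> g \in T -> ~~ joined (T :\ g) g.
Proof. by case/spanning_treeP => _; apply. Qed.

(** Removing [g] splits [T] into two parts, and [e] links them again. *)
Lemma swap_tree T g e : spanning_tree T -> g \in T -> ~~ joined (T :\ g) e ->
  spanning_tree (e |: T :\ g).
Proof.
move=> treeT gT Nge; have [a [b [_ gab]]] := edge_ends g.
have [c [d [_ ecd]]] := edge_ends e.
pose T' := e |: T :\ g.
have eT' : e \in T' by rewrite setU11.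
have subT' : T :\ g \subset T' by apply: finset.subsetUr.
(* The path of [T] between the ends of [e] crosses [g], so its two pieces together with [e] join the
   ends of [g]. *)
have T'g : joined T' g.
  have cdT' : connect (tadj T') c d by rewrite -(joinedE _ ecd) in_joined.
  move: Nge; rewrite (joinedE _ ecd) (joinedE _ gab).
  have := connectD1 gab (connect_tree c d treeT).
  case=> [->//|[ca bd] _|[cb ad] _].
    apply: (@connect_trans _ _ c); first by rewrite connect_tadjC (connect_tadjS subT').
    by rewrite (connect_trans cdT')// connect_tadjC (connect_tadjS subT').
  apply: (@connect_trans _ _ d); first exact: (connect_tadjS subT').
  rewrite connect_tadjC; apply: connect_trans cdT'.
  by rewrite connect_tadjC (connect_tadjS subT').
have conT' x y : connect (tadj T') x y.
  apply: connect_joined (connect_tree x y treeT) => h hT.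
  have [->//|hg] := eqVneq h g.
  by apply: in_joined; rewrite !inE hT hg orbT.
apply/spanning_treeP; split=> // h hT'; apply/negP => T'h.
have [he|he] := eqVneq h e.
  move: T'h; rewrite he => T'e; move/negP: Nge => []; apply: joinedS T'e.
  by rewrite finset.setDUl finset.setDv finset.set0U subsetDl.
have /andP[hg hT] : (h != g) && (h \in T).
  by move: hT'; rewrite !inE (negPf he).
have conB x y : connect (tadj (T' :\ h)) x y.
  apply: connect_joined (conT' x y) => f fT'.
  have [->//|fh] := eqVneq f h.
  by apply: in_joined; rewrite !inE fh; move: fT'; rewrite !inE.
have subB : T' :\ h :\ e \subset T :\ g :\ h.
  apply/fintype.subsetP => f; rewrite !inE => /and3P[/negPf-> -> /=].
  by case/andP=> -> ->.
have subh : T :\ g :\ h \subset T :\ h.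
  by apply/fintype.subsetP => f; rewrite !inE => /and3P[-> _ ->].
have abTh : connect (tadj (T :\ h)) a b.
  by rewrite -(joinedE _ gab) in_joined // !inE eq_sym hg.
(* The ends [a], [b] of [g] are joined in [T' :\ h], and this must go through [e], since [g] is a
   bridge of [T]. The two pieces avoid [h], so together with [g] they join [c] to [d] in
   [T :\ h]. *)
have Thcd : connect (tadj (T :\ h)) c d.
  have Tc u v : connect (tadj (T' :\ h :\ e)) u v -> connect (tadj (T :\ h)) u v.
    by move=> /(connect_tadjS subB) /(connect_tadjS subh).
  have := connectD1 ecd (conB a b); case=> [ab|[/Tc ac /Tc db]|[/Tc ad /Tc cb]].
  - move/negP: (tree_joinedN treeT gT) => []; rewrite (joinedE _ gab).
    by apply: connect_tadjS (connect_tadjS subB ab); rewrite subD1set.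
  - rewrite connect_tadjC in ac; apply: connect_trans ac _.
    by rewrite connect_tadjC in db; apply: connect_trans abTh _.
  - apply: (connect_trans cb); rewrite connect_tadjC.
    by apply: connect_trans abTh; rewrite connect_tadjC.
move/negP: (tree_joinedN treeT hT) => []; apply: joined_joined (joined_total conB h) => f.
rewrite !inE => /andP[fh /orP[/eqP->|/andP[_ fT]]]; first by rewrite (joinedE _ ecd).
by rewrite in_joined // !inE fh.
Qed.

(** If no edge of [A] crossed the cut left by removing [e], the ends of [e] would stay joined in
    [T :\ e], and [e] would not be a bridge. *)
Lemma exchange_tree T A e : spanning_tree T -> e \in T -> joined A e ->
  exists2 g, g \in A & ~~ joined (T :\ e) g.
Proof.
move=> treeT eT Ae; apply/exists_inP; apply: contraNT (tree_joinedN treeT eT).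
rewrite negb_exists_in => /forall_inP NA; apply: joined_joined Ae => g gA.
by have := NA g gA; rewrite negbK.
Qed.

Lemma notin_unjoined T e g : spanning_tree T -> ~~ joined (T :\ e) g -> g \notin T :\ e.
Proof. by move=> treeT; apply: contra => /in_joined. Qed.

(** Induction on the size of [T :\: T']: exchanging an edge of [T] outside [T'] for an edge of [T']
    keeps the size of [T] and brings it closer to [T']. *)
Lemma card_spanning_tree T T' : spanning_tree T -> spanning_tree T' -> #|T| = #|T'|.
Proof.
move: {2}_.+1 (ltnSn #|T :\: T'|) => m.
elim: m T => // m IHm T; rewrite ltnS => sz treeT treeT'.
have [sTT'|/fintype.subsetPn[e eT eT']] := boolP (T \subset T').
  congr #|pred_of_set _|; apply/eqP; rewrite finset.eqEsubset sTT'.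
  apply/fintype.subsetP => g gT'; apply/negPn/negP => gT.
  have /negP := tree_joinedN treeT' gT'; apply.
  apply: (@joinedS T); first by rewrite subsetD1 sTT'.
  by apply: joined_total => x y; exact: connect_tree.
have T'e : joined T' e by apply: joined_total => x y; exact: connect_tree.
have [g gT' Ng] := exchange_tree treeT eT T'e.
rewrite -(IHm (g |: T :\ e)) //; last exact: swap_tree.
  by rewrite cardsU1 (notin_unjoined treeT Ng) (cardsD1 e T) eT.
apply: leq_trans sz; rewrite (cardsD1 e (T :\: T')) inE eT eT' ltnS.
apply/subset_leq_card/fintype.subsetP => f; rewrite !inE.
case/andP=> fT' /orP[/eqP fg|/andP[-> ->]]; last by rewrite fT'.
by rewrite fg gT' in fT'.
Qed.

(** Seen from [x], every edge of [F] has a far end, which is cut off when [F] is removed; distinct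
    edges have distinct far ends. *)
Lemma card_tree_disconnected T F x : spanning_tree T -> F \subset T ->
  #|F| <= #|[set y | ~~ connect (tadj (T :\: F)) x y]|.
Proof.
move=> treeT /fintype.subsetP FT.
(* The default is not taken for [f] in [F], because removing a bridge disconnects one of its ends
   from [x]. *)
pose far f := odflt x [pick y in val f | ~~ connect (tadj (T :\ f)) x y].
have farP f : f \in F -> far f \in val f /\ ~~ connect (tadj (T :\ f)) x (far f).
  move=> /FT fT; rewrite /far; case: pickP => [y /andP[]//|far0].
  have [a [b [_ fab]]] := edge_ends f.
  have /negP[] := tree_joinedN treeT fT; rewrite (joinedE _ fab).
  have := far0 a; have := far0 b; rewrite fab set21 set22 /= => /negbFE xb /negbFE xa.
  by rewrite connect_tadjC in xa; exact: connect_trans xa xb.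
rewrite -(card_in_imset (f := far) (D := F)).
  apply/subset_leq_card/fintype.subsetP => _ /imsetP[f fF ->]; rewrite inE.
  apply: contra (farP f fF).2; apply: connect_tadjS; apply: finset.setDS.
  by rewrite finset.sub1set.
move=> f g fF gF yE; apply/eqP/negPn/negP => fg.
have [yf Nf] := farP f fF; have [yg Ng] := farP g gF.
move: yg Ng; rewrite -yE; move: (far f) yf Nf => y yf Nf yg Ng {yE farP}.
have other h : y \in val h -> exists c, val h = [set c; y].
  have [a [b [_ ->]]] := edge_ends h; rewrite !inE => /orP[]/eqP ->.
    by exists b; rewrite finset.setUC.
  by exists a.
have [c fcy] := other f yf; have [d gdy] := other g yg.
have fT := FT _ fF; have gT := FT _ gF.
have xc : connect (tadj (T :\ f)) x c.
  by have := connectD1 fcy (connect_tree x y treeT); case=> [xy|[]//|[xy]];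
    rewrite xy in Nf.
have sg : T :\ f :\ g \subset T :\ g.
  by apply/fintype.subsetP => h; rewrite !inE => /and3P[-> _ ->].
have sf : T :\ f :\ g \subset T :\ f by exact: subD1set.
(* Here [f] and [g] share the far end [y]. The path from [x] to the other end [c] of [f] either
   avoids [g] and then reaches [y] through [f], or continues from [y] to [c] and bypasses [f], or
   reaches [y] before crossing [g]. *)
have := connectD1 gdy xc; case=> [{}xc|[_ yc]|[xy _]].
- move/negP: Ng => []; apply: connect_trans (connect_tadjS sg xc) _.
  by rewrite -(joinedE _ fcy) in_joined // !inE fg.
- have /negP[] := tree_joinedN treeT fT; rewrite (joinedE _ fcy) connect_tadjC.
  exact: connect_tadjS yc.
- by move/negP: Ng => []; exact: connect_tadjS xy.
Qed.

(** The witness is a minimal subset of [T] connecting [a] to [b], that is, the tree path between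
    them. *)
Lemma tree_separators T a b : spanning_tree T ->
  exists A, [/\ A \subset T, connect (tadj A) a b &
    {in A, forall g, ~~ connect (tadj (T :\ g)) a b}].
Proof.
move=> treeT.
have [|A /minsetP[abA minA] AT] := @minset_exists _
  (fun A : {set edge n} => connect (tadj A) a b) T.
  exact: connect_tree.
exists A; split=> // g gA.
have Ng : ~~ connect (tadj (A :\ g)) a b.
  apply/negP => abg; have := minA _ abg (subD1set _ _).
  by move/setP/(_ g); rewrite !inE eqxx gA.
have [c [d [_ gcd]]] := edge_ends g; have gT := fintype.subsetP AT _ gA.
apply: contra (tree_joinedN treeT gT) => abg; rewrite (joinedE _ gcd).
have sub u v : connect (tadj (A :\ g)) u v -> connect (tadj (T :\ g)) u v.
  by apply: connect_tadjS; apply: finset.setSD.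
case: (connectD1 gcd abA) => [abA'|[/sub ac /sub db]|[/sub ad /sub cb]].
- by rewrite abA' in Ng.
- rewrite connect_tadjC in ac; apply: connect_trans ac _.
  by apply: connect_trans abg _; rewrite connect_tadjC.
- apply: connect_trans cb _; rewrite connect_tadjC.
  by apply: connect_trans abg; rewrite connect_tadjC.
Qed.

(* An edge is counted once for each ordered pair of its ends, but the bound by
   the four pairs of elements of [val e] is enough. *)
Lemma card_tadj A : \sum_x \sum_y (tadj A x y : nat) <= 4 * #|A|.
Proof.
apply: (@leq_trans (\sum_x \sum_y \sum_(e in A) ((x \in val e) * (y \in val e)))).
  apply: leq_sum => x _; apply: leq_sum => y _.
  have [/exists_inP[e eA /eqP exy]|//] := boolP (tadj A x y).
  by rewrite (bigD1 e) //= exy set21 set22.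
under eq_bigr do rewrite exchange_big /=.
rewrite exchange_big /= -sum1_card big_distrr /=; apply: leq_sum => e _.
under eq_bigr do rewrite -big_distrr /=.
by rewrite -big_distrl /= -big_mkcond /= sum1_card (eqP (valP e)).
Qed.

Lemma card_edge : #|{: edge n}| <= n ^ 2.
Proof.
rewrite card_sig -cardsE card_draws bin2 card_ord -mulnn leq_half_double.
by rewrite (@leq_trans (n * n)) ?leq_mul2l ?leq_pred ?orbT // -addnn -addSn leq_addl.
Qed.

End spanning_trees.

(** * Minimum and Gibbs trees, and their discrepancy, for fixed labels *)

Section labels.
Local Open Scope set_scope.
Local Open Scope ring_scope.
Variables (R : realType) (n : nat).
Implicit Types (A B F M T W : {set edge n}) (e f g h : edge n).
Implicit Types (u : edge n -> R) (x y z a b v : 'I_n) (q t : R).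

Lemma total_label_swap u T g e : g \in T -> e \notin T :\ g ->
  total_label u (e |: T :\ g) + u g = total_label u T + u e.
Proof.
move=> gT eT; rewrite /total_label (big_setU1 _ eT) /= (big_setD1 g gT) /=.
ring.
Qed.

(** The cycle property: an edge [g] on the tree path between the ends of [h] can be swapped for [h],
    so minimality forces [u g <= u h]. *)
Lemma mst_joined u M h : is_mst u M -> joined [set g in M | u g <= u h] h.
Proof.
case=> treeM minM; have [hM|hM] := boolP (h \in M).
  by apply: in_joined; rewrite inE hM lexx.
have [a [b [_ hab]]] := edge_ends h.
have [A [/fintype.subsetP AM abA sepA]] := tree_separators a b treeM.
rewrite (joinedE _ hab); apply: connect_tadjS abA.
apply/fintype.subsetP => g gA; have gM := AM _ gA; rewrite inE gM /=.
have Ngh : ~~ joined (M :\ g) h by rewrite (joinedE _ hab) sepA.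
have := minM _ (swap_tree treeM gM Ngh).
have := total_label_swap u gM (notin_unjoined treeM Ngh) => tot.
by move=> le_tot; rewrite -(lerD2l (total_label u M)) -tot lerD2r.
Qed.

(* The edges that may join the ends of [e] at level [t], [e] itself excluded so
   that this set does not depend on the label of [e]. *)
Definition below u e t := [set g | (g != e) && (u g <= t)].

Lemma belowS u e t t' : t <= t' -> below u e t \subset below u e t'.
Proof.
move=> tt'; apply/fintype.subsetP => g; rewrite !inE => /andP[-> ug].
exact: le_trans tt'.
Qed.

Lemma joined_below_mst u M e : is_mst u M -> e \notin M ->
  joined (below u e (u e)) e.
Proof.
move=> mstM eM; apply: joinedS (mst_joined e mstM).
apply/fintype.subsetP => g; rewrite !inE => /andP[gM ->]; rewrite andbT.
by apply: contraNneq eM => <-.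
Qed.

(** Removing the heavy edges from [M] cuts each [x] off from at least as many vertices [y] as there
    are heavy edges. For such a [y] the edge [xy] is not joined at level [q], since tree edges of
    label at most [q] already join the ends of every edge of label at most [q]. The factor 4 is that
    of [card_tadj]. *)
Lemma card_heavy u M q : is_mst u M ->
  (n * #|[set g in M | (q < u g)%R]| <= 4 * #|[set e | ~~ joined (below u e q) e]|)%N.
Proof.
move=> mstM; set F := [set g in M | _]; set D := [set e | _].
apply: leq_trans (card_tadj D).
rewrite -[X in (X * _)%N]card_ord -sum_nat_const; apply: leq_sum => x _.
have FM : F \subset M by apply/fintype.subsetP => g; rewrite inE => /andP[].
apply: leq_trans (card_tree_disconnected x mstM.1 FM) _.
rewrite -sum1_card big_mkcond /=; apply: leq_sum => y _; rewrite inE.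
case: ifPn => // Nxy; rewrite lt0b.
have xy : x != y by apply: contraNneq Nxy => ->; exact: connect0.
have card_xy : #|[set x; y]| == 2 by rewrite cards2 xy.
pose e : edge n := Sub [set x; y] card_xy.
have exy : val e = [set x; y] by [].
rewrite (tadj_edge _ exy) inE; apply: contra Nxy; rewrite -(joinedE _ exy).
apply: joined_joined => g; rewrite inE => /andP[_ ugq].
apply: joinedS (mst_joined g mstM); apply/fintype.subsetP => h.
by rewrite !inE => /andP[hM hg]; rewrite hM andbT -leNgt (le_trans hg ugq).
Qed.

Lemma sum_inj_le (I J : finType) (p : pred I) (phi : I -> J) (F : J -> R) :
  (forall j, 0 <= F j) -> {in p &, injective phi} ->
  \sum_(i | p i) F (phi i) <= \sum_j F j.
Proof.
move=> F0 inj_phi; rewrite -(big_imset (A := p) F inj_phi) /= [leLHS]big_mkcond.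
by apply: ler_sum => j _; case: ifP.
Qed.

(* Swapping a tree edge [e] for an edge [g] with [u g + delta <= u e] multiplies
   the Gibbs weight by at least [expR (beta * delta)], and the tree is recovered
   from [g] and the new tree. *)
Lemma wst_law_excess (beta delta : R) u e : 0 <= beta -> 0 < delta ->
  joined (below u e (u e - delta)) e ->
  \sum_(T : {set edge n} | spanning_tree T && (e \in T)) wst_law beta u T <=
  #|{: edge n}|%:R * expR (- beta * delta).
Proof.
move=> beta0 delta0; set A := below u e _ => Ae.
pose Z := \sum_(T : {set edge n} | spanning_tree T) expR (- beta * total_label u T).
pose F (gT : edge n * {set edge n}) : R := if spanning_tree gT.2 then
  expR (- beta * delta) * expR (- beta * total_label u gT.2) else 0.
have F0 gT : 0 <= F gT.
  by rewrite /F; case: ifP => // _; rewrite mulr_ge0 ?expR_ge0.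
(* [exchange_tree] supplies a suitable [g] whenever [e] lies in the tree [T], so the default [e] is
   not taken there. *)
pose sw T := odflt e [pick g in A | ~~ joined (T :\ e) g].
have swP T : spanning_tree T && (e \in T) ->
    [/\ sw T \in A, ~~ joined (T :\ e) (sw T), sw T \notin T :\ e & e != sw T].
  case/andP=> treeT eT; rewrite /sw; case: pickP => [g /andP[gA Ng]|no] /=.
    split=> //; first exact: notin_unjoined Ng.
    by apply/eqP => eg; move: gA; rewrite -eg inE eqxx.
  have [g gA Ng] := exchange_tree treeT eT Ae.
  by have := no g; rewrite gA Ng.
have FE T : spanning_tree T && (e \in T) ->
    expR (- beta * total_label u T) <= F (sw T, sw T |: T :\ e).
  move=> Te; have [swA Nsw swT _] := swP _ Te; case/andP: Te => treeT eT.
  rewrite /F /= swap_tree // -expRD ler_expR -mulrDr !mulNr lerN2.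
  apply: ler_wpM2l => //.
  have := total_label_swap u eT swT => tot.
  by move: swA; rewrite inE => /andP[_]; lra.
have Z0 : 0 <= Z by apply: sumr_ge0 => T _; exact: expR_ge0.
rewrite /wst_law -/Z -mulr_suml.
(* If [Z] vanishes, the law is zero by the convention [0^-1 = 0]. *)
have [->|Zneq0] := eqVneq Z 0; first by rewrite invr0 mulr0 mulr_ge0 ?expR_ge0.
rewrite ler_pdivrMr ?lt_neqAle 1?eq_sym ?Zneq0 //.
apply: le_trans (ler_sum _ FE) _.
apply: (@le_trans _ _ (\sum_gT F gT)).
  pose phi T := (sw T, sw T |: T :\ e).
  apply: (@sum_inj_le _ _ _ phi F F0) => T T' Te T'e eq_phi.
  have [_ _ swT nes] := swP _ Te; have [_ _ swT' _] := swP _ T'e.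
  have sE : sw T = sw T' := congr1 fst eq_phi.
  have := congr1 snd eq_phi; rewrite /= -sE => /(congr1 (fun X => X :\ sw T)).
  rewrite -sE in swT'; rewrite (setU1K swT) (setU1K swT').
  move=> /(congr1 (fun X => e |: X)).
  by case/andP: Te => _ eT; case/andP: T'e => _ eT'; rewrite !finset.setD1K.
rewrite -(pair_big xpredT xpredT (fun g T => F (g, T))) /= -sum1_card natr_sum.
rewrite -mulrA mulr_suml; apply: ler_sum => g _.
by rewrite mul1r /F /= -big_mkcond /= mulr_sumr.
Qed.

Definition nbhd M (S : {set 'I_n}) : {set 'I_n} :=
  S :|: [set v | [exists s in S, tadj M s v]].

Definition discrepancy M W : {set 'I_n} :=
  [set v | [exists y, tadj ((M :\: W) :|: (W :\: M)) v y]].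

(** Neighbourhoods are taken in [M] only, whose degrees the labels control. This suffices for [W]
    too, since a walk of length at most [k] from a vertex outside this set is the same in both
    trees. *)
Definition discrepancy_nbhd M W k := iter k (nbhd M) (discrepancy M W).

(** Spanning trees have equally many edges, so [M :\: W] and [W :\: M] have the same size, which
    gives a factor 2; the factor 4 is that of [card_tadj]. *)
Lemma card_discrepancy M W : spanning_tree M -> spanning_tree W ->
  (#|discrepancy M W| <= 8 * #|W :\: M|)%N.
Proof.
move=> treeM treeW; apply: (@leq_trans (4 * #|(M :\: W) :|: (W :\: M)|)).
  apply: leq_trans (card_tadj _); rewrite -sum1_card big_mkcond /=.
  apply: leq_sum => v _; rewrite inE; case: existsP => // -[y vy].
  by rewrite (bigD1 y) //= vy.
rewrite (_ : 8 = 4 * 2)%N // -mulnA leq_mul2l mul2n -addnn.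
apply: leq_trans (leq_card_setU _ _) _; rewrite leq_add2r.
have : #|M| = #|W| by exact: card_spanning_tree.
by rewrite -(cardsID W M) -(cardsID M W) finset.setIC => /addnI ->.
Qed.

Lemma iter_nbhdS M (S : {set 'I_n}) k : S \subset iter k (nbhd M) S.
Proof.
by elim: k => //= k IHk; apply: fintype.subset_trans IHk _; exact: finset.subsetUl.
Qed.

Lemma discrepancyN M W x y : x \notin discrepancy M W -> tadj M x y = tadj W x y.
Proof.
rewrite inE negb_exists => /forallP/(_ y); apply: contraNeq.
have [/exists_inP[e eM exy]|Mxy] := boolP (tadj M x y) => Wxy.
  apply/exists_inP; exists e => //; rewrite !inE eM /= andbT orbF.
  by apply: contra Wxy => eW; rewrite eq_sym eqb_id; apply/exists_inP; exists e.
move: Wxy; rewrite eq_sym eqbF_neg negbK => /exists_inP[e eW exy].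
apply/exists_inP; exists e => //; rewrite !inE eW /= andbT.
by apply: contra Mxy => eM; apply/exists_inP; exists e.
Qed.

(** Off the discrepancy set both trees have the same edges at [x], and the next vertex lies outside
    the neighbourhood of one order less, as otherwise [x] would lie in the larger one. *)
Lemma path_discrepancy M W r x p : x \notin discrepancy_nbhd M W r ->
  (size p <= r)%N -> path (tadj M) x p = path (tadj W) x p.
Proof.
elim: r x p => [|r IHr] x [|y p] //= Nx; rewrite ltnS => sp.
have tadjE : tadj M x y = tadj W x y.
  apply: discrepancyN; apply: contra Nx; apply: fintype.subsetP.
  exact: (iter_nbhdS _ _ r.+1).
rewrite tadjE; case: (boolP (tadj W x y)) => //= Wxy; apply: IHr => //.
apply: contra Nx => yS; rewrite inE; apply/orP; right; rewrite inE.
by apply/exists_inP; exists y => //; rewrite tadj_sym tadjE.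
Qed.

(** Adjacency inside the ball also concerns vertices at distance exactly [r], so the trees must
    agree at the endpoint of a walk of full length. *)
Lemma last_discrepancy M W r x p : x \notin discrepancy_nbhd M W r ->
  path (tadj M) x p -> (size p <= r)%N -> last x p \notin discrepancy M W.
Proof.
elim: r x p => [|r IHr] x [|y p] //= Nx.
  move=> _ _; apply: contra Nx; apply: fintype.subsetP; exact: (iter_nbhdS _ _ r.+1).
case/andP=> xy yp sp; apply: IHr => //; apply: contra Nx => yS.
rewrite inE; apply/orP; right; rewrite inE.
by apply/exists_inP; exists y => //; rewrite tadj_sym.
Qed.

Lemma rooted_ball_discrepancy M W r x :
  x \notin discrepancy_nbhd M W r ->
  rooted_ball r (rooted_tree M x) = rooted_ball r (rooted_tree W x).
Proof.
move=> Nx.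
have vertsE : ball_verts r (rooted_tree M x) = ball_verts r (rooted_tree W x).
  apply/seteqP; split=> y [p [/= xp py sp]]; exists p; split=> //=.
    by rewrite -(path_discrepancy Nx).
  by rewrite (path_discrepancy Nx).
rewrite /rooted_ball -vertsE; congr RootedGraph; apply/funext => y; apply/funext => z.
case: (boolP (y \in ball_verts r (rooted_tree M x))) => //=.
rewrite inE => -[p [/= xp <- sp]]; congr (_ && _).
exact/discrepancyN/(last_discrepancy Nx xp sp).
Qed.

(** Each degree in [M] splits into a light part, from labels at most [q], and a heavy part. A light
    degree [d] satisfies [d <= K + d ^ 2 / K]: over [S] the first term costs [K * #|S|], and the
    second, summed over all vertices, is a second moment damped by [1 / K]. *)
Lemma card_nbhd (K : R) u M q (S : {set 'I_n}) : 0 < K ->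
  #|nbhd M S|%:R <= (1 + K) * #|S|%:R +
    K^-1 * (\sum_x \sum_y \sum_z
      (tadj [set g | u g <= q] x y && tadj [set g | u g <= q] x z)%:R) +
    4 * #|[set g in M | q < u g]|%:R.
Proof.
move=> K0; set F := [set g in M | _]; set G := [set g | _].
pose deg A x := \sum_y (tadj A x y)%:R : R.
have deg0 A x : 0 <= deg A x by apply: sumr_ge0.
have cardS : #|nbhd M S|%:R <= #|S|%:R + \sum_(x in S) deg M x.
  apply: (@le_trans _ _ (#|S|%:R + #|[set v | [exists s in S, tadj M s v]]|%:R)).
    by rewrite -natrD ler_nat leq_card_setU.
  rewrite lerD2l exchange_big /= -sum1_card natr_sum big_mkcond /=.
  apply: ler_sum => v _; rewrite inE; case: ifPn => [/exists_inP[s sS sv]|_].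
    by rewrite (bigD1 s) //= sv lerDl sumr_ge0.
  by rewrite sumr_ge0.
have degM x : deg M x <= deg G x + deg F x.
  rewrite -big_split /=; apply: ler_sum => y _; rewrite -natrD ler_nat.
  have [/exists_inP[e eM exy]|//] := boolP (tadj M x y).
  have [uq|uq] := leP (u e) q.
    by rewrite (_ : tadj G x y) //; apply/exists_inP; exists e; rewrite ?inE.
  rewrite (_ : tadj F x y) ?leq_addl //; apply/exists_inP; exists e => //.
  by rewrite inE eM uq.
have degG x : deg G x <= K + K^-1 * deg G x ^+ 2.
  (* With [d] for [deg G x], multiplying by [K] turns the claim into
     [K ^ 2 - K * d + d ^ 2 >= 0]. *)
  rewrite -subr_ge0 -(pmulr_rge0 _ K0) mulrBr mulrDr mulrA divff ?gt_eqF // mul1r.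
  nra.
(* The expanded square counts pairs of edges at [x], and the expectation of such a count is a sum of
   probabilities. *)
have sqE x : deg G x ^+ 2 = \sum_y \sum_z (tadj G x y && tadj G x z)%:R.
  rewrite expr2 mulr_suml; apply: eq_bigr => y _; rewrite mulr_sumr.
  by apply: eq_bigr => z _; rewrite -natrM mulnb.
apply: (le_trans cardS); rewrite mulrDl mul1r -!addrA lerD2l.
apply: (le_trans (ler_sum _ (fun x _ => degM x))); rewrite big_split /= addrA.
apply: lerD; last first.
  have := card_tadj F; rewrite -(ler_nat R) natrM; apply: le_trans.
  rewrite natr_sum [leLHS]big_mkcond; apply: ler_sum => x _; rewrite natr_sum.
  by case: ifP => // _; apply: sumr_ge0.
apply: (le_trans (ler_sum _ (fun x _ => degG x))); rewrite big_split /=.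
apply: lerD; first by rewrite sumr_const mulr_natr lexx.
rewrite mulr_sumr [leLHS]big_mkcond; apply: ler_sum => x _; rewrite -sqE.
by case: ifP => _; rewrite ?lexx // mulr_ge0 ?sqr_ge0 // invr_ge0 ltW.
Qed.

End labels.

Local Open Scope classical_set_scope.
Local Open Scope ring_scope.

(** * Measurability of events that depend on finitely valued variables *)

Section finitely_valued.
Context (d : measure_display) (T : measurableType d).

Lemma measurable_finite_valued (F : finType) (X : T -> F) (Q : set F) :
  (forall x, measurable [set w | X w = x]) -> measurable [set w | Q (X w)].
Proof.
move=> mX; rewrite (_ : [set w | _] = \bigcup_(x in Q) [set w | X w = x]).
  by apply: fin_bigcup_measurable => //; exact: finite_finset.
by apply/seteqP; split=> [w Qw|w [x Qx /= ->//]]; exists (X w).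
Qed.

Lemma measurable_finset_valued (F : finType) (X : T -> {set F}) (Q : set {set F}) :
  (forall x, measurable [set w | x \in X w]) -> measurable [set w | Q (X w)].
Proof.
move=> mX; apply: measurable_finite_valued => A.
rewrite (_ : [set w | _] = \bigcap_(x in setT) [set w | (x \in X w) = (x \in A)]).
  apply: fin_bigcap_measurable => [|x _]; first exact: finite_finset.
  case: (x \in A); first exact: mX.
  rewrite (_ : [set w | _] = ~` [set w | x \in X w]); first exact: measurableC.
  by apply/seteqP; split=> w /=; [move=> ->|move/negP/negbTE].
apply/seteqP; split=> w /= Xw; first by move=> x _ /=; rewrite Xw.
by apply/setP => x; exact: Xw.
Qed.

Lemma measurable_discrete (F : finType) (X : T -> F) (Q : set F) :
  discrete_system X `<=` measurable -> measurable [set w | Q (X w)].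
Proof. by apply; exists Q => //; rewrite setTI. Qed.

Lemma measurable_discrete2 (F G : finType) (X : T -> F) (Y : T -> G)
    (Q : F -> set G) :
  discrete_system X `<=` measurable -> discrete_system Y `<=` measurable ->
  measurable [set w | Q (X w) (Y w)].
Proof.
move=> mX mY.
apply: (@measurable_finite_valued _ (fun w => (X w, Y w)) (fun xy => Q xy.1 xy.2)).
move=> [x y]; rewrite (_ : [set w | _] = [set w | X w = x] `&` [set w | Y w = y]).
  by apply: measurableI; [exact: (measurable_discrete (eq^~ x) mX)|
    exact: (measurable_discrete (eq^~ y) mY)].
by apply/seteqP; split=> [w /= [Xw Yw]//|w /= [-> ->]].
Qed.

Lemma discrete_system_pair (F G : finType) (X : T -> F) (Y : T -> G) :
  discrete_system X `<=` measurable -> discrete_system Y `<=` measurable ->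
  discrete_system (fun w => (X w, Y w)) `<=` measurable.
Proof.
move=> mX mY _ [B _ <-]; rewrite setTI.
exact: (measurable_discrete2 (fun x y => B (x, y)) mX mY).
Qed.

End finitely_valued.

(** * Real-valued probabilities and expectations of weighted counts *)

Section probability_of_predicates.
Context (R : realType) (d : measure_display) (T : measurableType d)
  (P : probability T R).

Definition pr (p : pred T) : R := fine (P [set w | p w]).

Lemma prE (p : pred T) : measurable [set w | p w] -> (pr p)%:E = P [set w | p w].
Proof. by move=> mp; rewrite fineK // fin_num_measure. Qed.

Lemma pr_ge0 (p : pred T) : 0 <= pr p.
Proof. by rewrite fine_ge0. Qed.

Lemma pr_le1 (p : pred T) : measurable [set w | p w] -> pr p <= 1.
Proof. by move=> mp; rewrite -lee_fin prE // probability_le1. Qed.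

Lemma indic_pred (p : pred T) w : (p w)%:R = \1_[set w | p w] w :> R.
Proof. by rewrite indicE; congr ((nat_of_bool _)%:R); apply/idP/idP; rewrite inE. Qed.

Lemma integral_sum_pr (I : finType) (a : I -> R) (p : I -> pred T) :
  (forall i, 0 <= a i) -> (forall i, measurable [set w | p i w]) ->
  (\int[P]_w (\sum_i a i * (p i w)%:R)%:E)%E = (\sum_i a i * pr (p i))%:E.
Proof.
move=> a0 mp.
have pE i w : (p i w)%:R = \1_[set w | p i w] w :> R.
  exact: indic_pred.
under eq_integral do rewrite -sumEFin.
rewrite ge0_integral_sum //; first last.
- by move=> i w _; rewrite lee_fin mulr_ge0.
- move=> i; apply/measurable_EFinP; apply: measurable_funM => //.
  under eq_fun do rewrite pE.
  exact: measurable_indic.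
rewrite -sumEFin; apply: eq_bigr => i _; rewrite EFinM prE //.
under eq_integral do rewrite pE EFinM.
rewrite ge0_integralZl_EFin //.
- by rewrite integral_indic // setIT.
- exact/measurable_EFinP/measurable_indic.
Qed.

(** Both sides are integrated. This carries the counting bounds, which hold for fixed labels, over
    to sums of probabilities. *)
Lemma ae_sum_pr_le (I J : finType) (a : I -> R) (p : I -> pred T)
    (b : J -> R) (q : J -> pred T) :
  (forall i, 0 <= a i) -> (forall i, measurable [set w | p i w]) ->
  (forall j, 0 <= b j) -> (forall j, measurable [set w | q j w]) ->
  {ae P, forall w, \sum_i a i * (p i w)%:R <= \sum_j b j * (q j w)%:R} ->
  \sum_i a i * pr (p i) <= \sum_j b j * pr (q j).
Proof.
have msum (K : finType) (c : K -> R) (r : K -> pred T) :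
    (forall i, measurable [set w | r i w]) ->
    measurable_fun setT (fun w => (\sum_i c i * (r i w)%:R)%:E).
  move=> mr; apply/measurable_EFinP; apply: measurable_sum => i.
  apply: measurable_funM => //.
  rewrite (_ : (fun _ => _) = \1_[set w | r i w]); first exact: measurable_indic.
  by apply/funext => w; exact: indic_pred.
move=> a0 mp b0 mq pq; rewrite -lee_fin -!integral_sum_pr //.
apply: ae_ge0_le_integral => //.
- by move=> w _; rewrite lee_fin sumr_ge0 // => i _; rewrite mulr_ge0.
- exact: msum.
- by move=> w _; rewrite lee_fin sumr_ge0 // => i _; rewrite mulr_ge0.
- exact: msum.
- by apply: filterS pq => w pqw _; rewrite lee_fin.
Qed.

Lemma ae_pr_le_sum (J : finType) (p : pred T) (b : J -> R) (q : J -> pred T) :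
  measurable [set w | p w] ->
  (forall j, 0 <= b j) -> (forall j, measurable [set w | q j w]) ->
  {ae P, forall w, p w -> 1 <= \sum_j b j * (q j w)%:R} ->
  pr p <= \sum_j b j * pr (q j).
Proof.
move=> mp b0 mq pq.
have := @ae_sum_pr_le unit J (fun=> 1) (fun=> p) b q.
rewrite big_const card_unit /= mul1r addr0; apply=> //.
apply: filterS pq => w; rewrite big_const card_unit /= mul1r addr0.
case: (p w) => [/(_ isT)//|_]; apply: sumr_ge0 => j _; exact: mulr_ge0.
Qed.

Lemma ae_pr_le (p q : pred T) :
  measurable [set w | p w] -> measurable [set w | q w] ->
  {ae P, forall w, p w -> q w} -> pr p <= pr q.
Proof.
move=> mp mq pq.
have := @ae_pr_le_sum unit p (fun=> 1) (fun=> q) mp.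
rewrite big_const card_unit /= mul1r addr0; apply=> //.
by apply: filterS pq => w pqw /pqw ->; rewrite big_const card_unit /= mul1r addr0.
Qed.

End probability_of_predicates.

(** * The law of a single uniform label *)

Section uniform_labels.
Context (R : realType) (d : measure_display) (T : measurableType d)
  (P : probability T R) (X : {RV P >-> R}).
Hypothesis unifX : forall B : set R, measurable B ->
  distribution P X B = uniform_prob (@ltr01 R) B.

Lemma uniform_set (B : set R) : measurable B ->
  P (X @^-1` B) = lebesgue_measure (B `&` `[0, 1]).
Proof.
move=> mB; have := unifX mB; rewrite /distribution /pushforward => ->.
rewrite /uniform_prob integral_uniform_pdf.
rewrite (eq_integral (cst 1%E)).
  by rewrite integral_cst ?mul1e //; apply: measurableI.
move=> x; rewrite inE => -[_ /=]; rewrite in_itv /= /uniform_pdf => ->.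
by rewrite subr0 invr1.
Qed.

Lemma uniform_le (q : R) : 0 <= q <= 1 -> pr P (fun w => X w <= q) = q.
Proof.
move=> /andP[q0 q1]; rewrite /pr.
have -> : [set w | X w <= q] = X @^-1` `]-oo, q].
  by apply/seteqP; split=> w /=; rewrite in_itv.
rewrite uniform_set // (_ : _ `&` _ = `[0, q]%classic).
  by rewrite lebesgue_measure_itv /= lte_fin; case: (ltP 0 q) => [_|q0'] /=;
    rewrite ?oppr0 ?addr0 ?subr0 //; apply/eqP; rewrite eq_le q0 q0'.
apply/seteqP; split=> x /=; rewrite !in_itv /=; first by move=> [-> /andP[->]].
by move=> /andP[-> xq]; rewrite xq (le_trans xq q1).
Qed.

Lemma uniform_itv (a b : R) : 0 <= a -> a < b -> b <= 1 ->
  pr P (fun w => a <= X w < b) = b - a.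
Proof.
move=> a0 ab b1; rewrite /pr.
have -> : [set w | a <= X w < b] = X @^-1` `[a, b[.
  by apply/seteqP; split=> w /=; rewrite in_itv.
rewrite uniform_set // (_ : _ `&` _ = `[a, b[%classic).
  by rewrite lebesgue_measure_itv /= lte_fin ab.
apply/seteqP; split=> x /=; rewrite !in_itv /=; first by move=> [].
move=> /[dup] /andP[ax xb] ->; rewrite (le_trans a0 ax) (le_trans (ltW xb) b1).
by [].
Qed.

(** The value 1 has probability zero; leaving it out lets the half-open bins [[j/m, (j+1)/m[] with
    [j < m] cover every label. *)
Lemma uniform_ae : {ae P, forall w, 0 <= X w < 1}.
Proof.
have m01 : measurable [set w | 0 <= X w < 1].
  rewrite (_ : [set w | _] = X @^-1` `[0, 1[).
    by rewrite -[X in measurable X]setTI; exact: measurable_funP.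
  by apply/seteqP; split=> w /=; rewrite in_itv.
have PC : P (~` [set w | 0 <= X w < 1]) = 0%E.
  by rewrite probability_setC // -prE // uniform_itv // subr0 subee.
by exists (~` [set w | 0 <= X w < 1]); split=> //; exact: measurableC.
Qed.

End uniform_labels.

Section sums.
Context (R : realType) (d : measure_display) (T : measurableType d)
  (P : probability T R).

Lemma pr_sum (I : finType) (p : pred T) (q : I -> pred T) :
  measurable [set w | p w] -> (forall i, measurable [set w | q i w]) ->
  (forall w, (p w : nat) = \sum_i q i w)%N ->
  pr P p = \sum_i pr P (q i).
Proof.
move=> mp mq pq; apply/EFin_inj.
have := @integral_sum_pr _ _ _ P I (fun=> 1) q (fun=> ler01) mq.
under [X in _ = X%:E -> _]eq_bigr do rewrite mul1r.
move=> <-; rewrite prE // -[in LHS](setIT [set w | p w]) -integral_indic //.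
apply: eq_integral => w _; rewrite -indic_pred pq natr_sum.
by congr EFin; apply: eq_bigr => i _; rewrite mul1r.
Qed.

Lemma pr0 : pr P xpred0 = 0.
Proof.
rewrite /pr (_ : [set w | _] = set0) ?measure0 //.
by apply/seteqP; split.
Qed.

End sums.

(** * Independence of one label from the others *)

Section independent_labels.
Context (R : realType) (d : measure_display) (T : measurableType d)
  (P : probability T R) (I : finType) (X : I -> {RV P >-> R}).
Hypothesis indX : mutually_independent X.

Lemma measurable_rv (b : pred R) e :
  measurable [set x | b x] -> measurable [set w | b (X e w)].
Proof.
move=> mb; have mX : measurable_fun setT (X e) by exact: measurable_funP.
by have := mX measurableT _ mb; rewrite setTI.
Qed.

Lemma measurable_below e t (Q : set {set I}) :
  measurable [set w | Q [set g | (g != e) && (X g w <= t)]%SET].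
Proof.
apply: (measurable_finset_valued Q) => g.
have [->|ge] := eqVneq g e.
  rewrite (_ : [set w | _] = set0) //.
  by apply/seteqP; split=> w //=; rewrite inE eqxx.
rewrite (_ : [set w | _] = [set w | X g w <= t]).
  apply: (measurable_rv (b := fun x => x <= t)).
  by rewrite (_ : [set x | _] = `]-oo, t]%classic).
by apply/seteqP; split=> w /=; rewrite inE ge.
Qed.

(** Split according to the value [S] of the random set. That it equals [S] is a condition on each
    label other than that of [e], so mutual independence factors out the label of [e]. *)
Lemma independent_below (b : pred R) e t (Phi : pred {set I}) :
  measurable [set x | b x] ->
  pr P (fun w => b (X e w) && Phi [set g | (g != e) && (X g w <= t)]%SET) =
  pr P (fun w => b (X e w)) *
  pr P (fun w => Phi [set g | (g != e) && (X g w <= t)]%SET).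
Proof.
move=> mb; pose A w := [set g | (g != e) && (X g w <= t)]%SET.
rewrite -[LHS]/(pr P (fun w => b (X e w) && Phi (A w))).
rewrite -[X in _ = _ * X]/(pr P (fun w => Phi (A w))).
have mA Q : measurable [set w | Q (A w)] by exact: measurable_below.
have mbX : measurable [set w | b (X e w)] by exact: measurable_rv.
have mbA (Q : pred {set I}) : measurable [set w | b (X e w) && Q (A w)].
  rewrite (_ : [set w | _] = [set w | b (X e w)] `&` [set w | Q (A w)]).
    by apply: measurableI => //; exact: (mA (fun S => Q S)).
  by apply/seteqP; split=> w /=; [move/andP|move=> H; apply/andP].
rewrite (@pr_sum _ _ _ P _ _ (fun S w => b (X e w) && ((A w == S) && Phi S))).
rewrite (@pr_sum _ _ _ P _ (fun w => Phi (A w)) (fun S w => (A w == S) && Phi S)).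
- rewrite mulr_sumr; apply: eq_bigr => S _.
  have [/negPf NPhiS|PhiS] : ~~ Phi S \/ Phi S by apply/orP; exact: orNb.
    rewrite (_ : (fun w => _ && _) = xpred0); last first.
      by apply/funext => w; rewrite NPhiS !andbF.
    rewrite (_ : (fun w => _ && _) = xpred0); last first.
      by apply/funext => w; rewrite NPhiS andbF.
    by rewrite pr0 mulr0.
  have [eS|eS] := boolP (e \in S).
    have NA w : A w == S = false.
      by apply/eqP => /setP/(_ e); rewrite !inE eqxx eS.
    rewrite (_ : (fun w => _ && _) = xpred0); last first.
      by apply/funext => w; rewrite NA andbF.
    rewrite (_ : (fun w => _ && _) = xpred0); last first.
      by apply/funext => w; rewrite NA.
    by rewrite pr0 mulr0.
  (* One condition per label: [c] at [e], and at any other [g] the inequality that decides whether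
     [g] belongs to [S]. *)
  pose C (c : pred R) g : set R := [set x | if g == e then c x
    else if g \in S then x <= t else x > t].
  have mC (c : pred R) g : measurable [set x | c x] -> measurable (C c g).
    move=> mc; rewrite /C; case: (g == e) => //; case: (g \in S).
      by rewrite (_ : [set x | _] = `]-oo, t]%classic).
    by rewrite (_ : [set x | _] = `]t, +oo[%classic) // set_itvoy.
  have CE (c : pred R) : [set w | c (X e w) && ((A w == S) && Phi S)] =
      \bigcap_(g in [set` [set: I]%SET]) (X g @^-1` C c g).
    apply/seteqP; split=> w /=.
      case/andP=> cw /andP[/eqP AS _] g _; rewrite /C /=.
      case: eqVneq => [->//|ge]; rewrite -AS inE ge /=.
      by case: leP.
    move=> Cw; apply/andP; split.
      by have := Cw e; rewrite /C /= eqxx; apply; rewrite inE.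
    rewrite PhiS andbT; apply/eqP/setP => g; rewrite inE.
    have := Cw g; rewrite /C /= inE => /(_ isT).
    case: eqVneq => [->|ge]; first by rewrite (negPf eS).
    by case: ifP => //= _; rewrite ltNge => /negbTE.
  have PC (c : pred R) : measurable [set x | c x] ->
      (P [set w | c (X e w) && ((A w == S) && Phi S)] =
      P [set w | c (X e w)] * \prod_(g in [set: I]%SET | g != e) P (X g @^-1` C xpredT g))%E.
    move=> mc; rewrite CE indX; last by move=> g; exact: mC.
    rewrite (bigD1 e) //=; congr (_ * _)%E.
      by congr (P _); apply/seteqP; split=> w /=; rewrite /C /= eqxx.
    apply: eq_bigr => g /andP[_ ge]; congr (P _).
    by rewrite /C (negPf ge).
  have trueT (U : Type) : [set _ : U | true] = setT by apply/seteqP; split.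
  have mT : measurable [set x : R | xpredT x] by rewrite trueT.
  (* With the trivial condition at [e], the product over the other labels is recognized as the
     probability that the random set equals [S]. *)
  have PT := PC xpredT mT; rewrite /= trueT probability_setT mul1e in PT.
  rewrite /pr /= (PC b mb) -PT fineM // fin_num_measure //.
  exact: (mA (fun S' => (S' == S) && Phi S)).
- exact: (mA (fun S => Phi S)).
- by move=> S; exact: (mA (fun S' => (S' == S) && Phi S)).
- move=> w; rewrite (bigD1 (A w)) //= eqxx big1 ?addn0 // => S.
  by rewrite eq_sym => /negPf ->.
- exact: mbA.
- by move=> S; exact: (mbA (fun S' => (S' == S) && Phi S)).
- move=> w; rewrite (bigD1 (A w)) //= eqxx big1 ?addn0 // => S.
  by rewrite eq_sym => /negPf ->; rewrite andbF.
Qed.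

Lemma independent_pair (b : pred R) e f : e != f -> measurable [set x | b x] ->
  pr P (fun w => b (X e w) && b (X f w)) =
  pr P (fun w => b (X e w)) * pr P (fun w => b (X f w)).
Proof.
move=> ef mb; have := @indX [set e; f]%SET (fun=> [set x | b x]) (fun=> mb).
rewrite big_setU1 ?inE //= big_set1 /pr => E.
rewrite (_ : [set w | _] = \bigcap_(i in [set` [set e; f]%SET]) X i @^-1` [set x | b x]).
  by rewrite E fineM // fin_num_measure //; exact: measurable_rv.
apply/seteqP; split=> w /=.
  by case/andP=> be bf g /=; rewrite !inE => /orP[]/eqP->.
by move=> bw; apply/andP; split; apply: bw; rewrite /= !inE eqxx ?orbT.
Qed.

End independent_labels.

Lemma card_sum_in (R : pzSemiRingType) (I : finType) (A : {set I}) :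
  #|A|%:R = \sum_i (i \in A)%:R :> R.
Proof. by rewrite -sum1_card big_mkcond natr_sum; apply: eq_bigr => i _; case: ifP. Qed.

Lemma sum_triple (R : nmodType) (I : finType) (F : I -> I -> I -> R) :
  \sum_x \sum_y \sum_z F x y z = \sum_t F t.1 t.2.1 t.2.2.
Proof.
rewrite -(pair_bigA _ (fun x p => F x p.1 p.2)) /=; apply: eq_bigr => x _.
exact: (pair_bigA _ (F x)).
Qed.

(** * Expected discrepancy of the coupled trees and its growth under neighbourhoods *)

Section coupling.
Context (R : realType) (d : measure_display) (T : measurableType d)
  (P : probability T R) (n : nat) (beta : R) (U : edge n -> {RV P >-> R})
  (M W : T -> {set edge n}) (o : T -> 'I_n).
Hypotheses (beta_ge0 : 0 <= beta) (cpl : mst_wst_coupling beta U M W o).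

Let mM (Q : set {set edge n}) : measurable [set w | Q (M w)].
Proof. exact/measurable_discrete/(cpl_M_measurable cpl). Qed.

Let mMW (Q : {set edge n} -> set {set edge n}) : measurable [set w | Q (M w) (W w)].
Proof.
exact: (measurable_discrete2 Q (cpl_M_measurable cpl) (cpl_W_measurable cpl)).
Qed.

Let measurable_le_label e t : measurable [set w | U e w <= t].
Proof.
apply: (@measurable_rv _ _ _ _ _ U (fun x => x <= t) e).
by rewrite (_ : [set x | _] = `]-oo, t]%classic).
Qed.

Lemma measurable_joined_below e t (b : bool) :
  measurable [set w | joined (below (U^~ w) e t) e = b].
Proof. exact: (measurable_below U e t (fun A => joined A e = b)). Qed.

(** The conditional law of [W] given the labels may be integrated only over events generated by the
    labels, so plain measurability would not be enough. *)
Lemma joined_below_gibbs_event e delta :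
  <<s rv_system U >> [set w | joined (below (U^~ w) e (U e w - delta)) e].
Proof.
pose TU := g_sigma_algebraType (rv_system U).
have mU g : measurable_fun (setT : set TU) (U g : TU -> R).
  move=> _ B mB; apply: sub_sigma_algebra.
  by exists g => //; exists B.
apply: (@measurable_finset_valued _ TU _ (fun w => below (U^~ w) e (U e w - delta))
  (fun A => joined A e)) => g.
have [->|ge] := eqVneq g e.
  rewrite (_ : [set w | _] = set0) //.
  by apply/seteqP; split=> w //=; rewrite inE eqxx.
rewrite (_ : [set w | _] = [set w : TU | U g w <= U e w - delta]); last first.
  by apply/seteqP; split=> w /=; rewrite inE ge.
have mle : measurable_fun (setT : set TU) (fun w : TU => U g w <= U e w - delta).
  apply: measurable_fun_ler; first exact: mU.
  by apply: measurable_funB => //; exact: mU.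
have := mle measurableT [set true]; rewrite setTI; apply.
by [].
Qed.

Lemma rv_system_measurable : <<s rv_system U >> `<=` measurable.
Proof.
apply: smallest_sub; first exact: sigma_algebra_measurable.
move=> _ [e _ [B mB <-]].
have mU : measurable_fun setT (U e) by exact: measurable_funP.
exact: mU.
Qed.

(** The excess event depends on the labels alone, so integrating the conditional law over it makes
    the pointwise bound [wst_law_excess] unconditional. *)
Lemma wst_excess e delta : 0 < delta ->
  pr P (fun w => (e \in W w) && joined (below (U^~ w) e (U e w - delta)) e) <=
  #|{: edge n}|%:R * expR (- beta * delta).
Proof.
move=> delta0; set c := _ * expR _.
pose G w := joined (below (U^~ w) e (U e w - delta)) e.
have sG : <<s rv_system U >> [set w | G w] by exact: joined_below_gibbs_event.
have mG : measurable [set w | G w] by exact: rv_system_measurable.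
have mGW (Q : set {set edge n}) : measurable ([set w | G w] `&` [set w | Q (W w)]).
  apply: measurableI => //; exact: measurable_discrete (cpl_W_measurable cpl).
pose t A := spanning_tree A && (e \in A).
pose f A w : R := if t A then wst_law beta (U^~ w) A else 0.
have f0 A w : 0 <= f A w.
  rewrite /f; case: ifP => // _; rewrite mulr_ge0 ?expR_ge0 // invr_ge0.
  by apply: sumr_ge0 => B _; exact: expR_ge0.
have mf A : measurable_fun [set w | G w] (EFin \o f A).
  rewrite /f; have [tA|_] := boolP (t A); last exact: measurable_cst.
  have [_ intf _] := cpl_W_law cpl (proj1 (andP tA)).
  exact: measurable_funTS (measurable_int _ intf).
have fP A : t A -> (\int[P]_(w in [set w | G w]) (f A w)%:E =
    (pr P (fun w => G w && (W w == A)))%:E)%E.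
  move=> tA; have [_ _ /(_ _ sG)] := cpl_W_law cpl (proj1 (andP tA)).
  rewrite /f tA => ->.
  have setE : [set w | G w && (W w == A)] = [set w | G w] `&` [set w | W w = A].
    by apply/seteqP; split=> w /=; [case/andP=> ? /eqP|case=> -> /eqP].
  by rewrite prE setE //; exact: (mGW (fun B => B = A)).
apply: (@le_trans _ _ (\sum_A (t A)%:R * pr P (fun w => G w && (W w == A)))).
  apply: ae_pr_le_sum => //.
  - rewrite (_ : [set w | _] = [set w | G w] `&` [set w | e \in W w]).
      exact: (mGW (fun A => e \in A)).
    by apply/seteqP; split=> w /=; [case/andP|case=> ? ?; apply/andP].
  - move=> A; rewrite (_ : [set w | _] = [set w | G w] `&` [set w | W w == A]).
      exact: (mGW (fun B => B == A)).
    by apply/seteqP; split=> w /=; [case/andP|case=> ? ?; apply/andP].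
  - apply: filterS (cpl_W_tree cpl) => w treeW /andP[eW Gw].
    have {}Gw : G w = true by [].
    rewrite (bigD1 (W w)) //= /t treeW eW Gw eqxx mulr1 lerDl.
    by apply: sumr_ge0 => A _; rewrite mulr_ge0.
rewrite -lee_fin -sumEFin.
rewrite (eq_bigr (fun A => (\int[P]_(w in [set w | G w]) (f A w)%:E)%E)); last first.
  move=> A _; case: (boolP (t A)) => tA; first by rewrite mul1r fP.
  rewrite mul0r; apply/esym; apply: integral0_eq => w _.
  by rewrite /f (negPf tA).
rewrite -ge0_integral_sum //; last by move=> A w _; rewrite lee_fin.
apply: (@le_trans _ _ (\int[P]_(w in [set w | G w]) c%:E)%E).
  apply: ge0_le_integral => //.
  - by move=> w _; rewrite sumEFin lee_fin sumr_ge0.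
  - exact: emeasurable_sum.
  - by move=> w Gw; rewrite sumEFin lee_fin -big_mkcond /=; exact: wst_law_excess.
rewrite integral_cst // -[leRHS]mule1; apply: lee_wpmul2l.
  by rewrite lee_fin mulr_ge0 ?expR_ge0.
exact: probability_le1.
Qed.

Let measurable_joined_excess e delta (b : bool) :
  measurable [set w | joined (below (U^~ w) e (U e w - delta)) e = b].
Proof.
have mj : measurable [set w | joined (below (U^~ w) e (U e w - delta)) e].
  by apply: rv_system_measurable; exact: joined_below_gibbs_event.
case: b => //; rewrite (_ : [set w | _] =
  ~` [set w | joined (below (U^~ w) e (U e w - delta)) e]); first exact: measurableC.
by apply/seteqP; split=> w /=; [move=> ->|move/negP/negbTE].
Qed.

Let measurable_joined_self e : measurable [set w | joined (below (U^~ w) e (U e w)) e].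
Proof.
rewrite (_ : [set w | _] = [set w | joined (below (U^~ w) e (U e w - 0)) e]).
  exact: (measurable_joined_excess e 0 true).
by apply/seteqP; split=> w /=; rewrite subr0.
Qed.

Let measurableIb (p q : pred T) : measurable [set w | p w] ->
  measurable [set w | q w] -> measurable [set w | p w && q w].
Proof.
move=> mp mq; rewrite (_ : [set w | _] = [set w | p w] `&` [set w | q w]).
  exact: measurableI.
by apply/seteqP; split=> w /=; [move/andP|move=> ?; apply/andP].
Qed.

Let measurableNb (p : pred T) : measurable [set w | p w] ->
  measurable [set w | ~~ p w].
Proof.
move=> mp; rewrite (_ : [set w | _] = ~` [set w | p w]); first exact: measurableC.
by apply/seteqP; split=> w /=; move/negP.
Qed.

(* The threshold at which the other edges join the ends of [e] is independent
   of the label of [e]; with bins of width [1/m] for the label, the probability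
   that the threshold lies within [1/m] below it telescopes. *)
Lemma pr_critical e (m : nat) : (0 < m)%N ->
  pr P (fun w => joined (below (U^~ w) e (U e w)) e &&
    ~~ joined (below (U^~ w) e (U e w - m%:R^-1)) e) <= 2 / m%:R.
Proof.
move=> m0; have mR0 : 0 < m%:R :> R by rewrite ltr0n.
(* [l j] is [(j - 1) / m]. For a label in bin [j], the level [1/m] below it is at least [l j], and
   the label itself is at most [l j.+2]; so in the event [H] the ends of [e] are unjoined at [l j]
   and joined at [l j.+2]. *)
set H := fun w => _; pose l j : R := j%:R / m%:R - m%:R^-1.
pose b j (x : R) := j%:R / m%:R <= x < j.+1%:R / m%:R.
pose c j w := joined (below (U^~ w) e (l j)) e.
have mb j : measurable [set x | b j x].
  by rewrite (_ : [set x | _] = `[j%:R / m%:R, j.+1%:R / m%:R[%classic).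
have mc j : measurable [set w | c j w] by exact: (measurable_joined_below e (l j) true).
have mbc i j : measurable [set w | b i (U e w) && c j w].
  by apply: measurableIb => //; apply: measurable_rv.
have cS j w : c j w -> c j.+2 w.
  apply/joinedS/belowS; rewrite lerD2r ler_pM2r ?invr_gt0 //.
  by rewrite ler_nat leqW.
have mH : measurable [set w | H w].
  apply: measurableIb; last by apply: measurableNb; exact: (measurable_joined_excess e _ true).
  exact: measurable_joined_self.
have prbc (i : 'I_m) j : pr P (fun w => b i (U e w) && c j w) = m%:R^-1 * pr P (c j).
  rewrite (independent_below (cpl_U_independent cpl) e (l j) (fun A => joined A e)) //.
  congr (_ * _); rewrite (uniform_itv (cpl_U_uniform cpl e)).
  - by rewrite -mulrBl -natrB // subSnn div1r.
  - by rewrite divr_ge0.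
  - by rewrite ltr_pM2r ?invr_gt0 // ltr_nat.
  - by rewrite ler_pdivrMr // mul1r ler_nat.
have bin w : 0 <= U e w < 1 ->
    exists j : 'I_m, b j (U e w) /\ (H w -> ~~ c j w /\ c j.+2 w).
  case/andP=> U0 U1; have Um0 : 0 <= U e w * m%:R by rewrite mulr_ge0.
  have /andP[jU Uj] := truncn_itv Um0.
  have jm : (Num.truncn (U e w * m%:R) < m)%N.
    rewrite -(ltr_nat R); apply: le_lt_trans jU _.
    by rewrite -[ltRHS]mul1r ltr_pM2r.
  exists (Ordinal jm); split; first by rewrite /b ler_pdivrMr // jU ltr_pdivlMr.
  case/andP=> cU NcU; split.
    apply: contraNN NcU; apply/joinedS/belowS.
    by rewrite /l lerD2r ler_pdivrMr.
  apply: joinedS cU; apply: belowS; rewrite /l -[_.+2]addn1 natrD mulrDl.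
  by rewrite div1r addrK ltW // ltr_pdivlMr.
clearbody H b c; pose p (i : unit + 'I_m) :=
  if i is inr j then (fun w => b j (U e w) && c j w) else H.
(* When the label falls in bin [j], the events [H] and [c j] are disjoint and both imply
   [c j.+2]. *)
have Hsum : \sum_i 1 * pr P (p i) <=
    \sum_(j < m) 1 * pr P (fun w => b j (U e w) && c j.+2 w).
  apply: ae_sum_pr_le => //; first by case=> [[]|j]; [exact: mH|exact: mbc].
  apply: filterS (uniform_ae (cpl_U_uniform cpl e)) => w /bin[j0 [bj0 Hj0]].
  rewrite big_sumType /= big_const card_unit /= addr0 mul1r.
  rewrite (bigD1 j0) //= [leRHS](bigD1 j0) //= bj0 /= addrA.
  apply: lerD; last first.
    apply: ler_sum => j _; rewrite !mul1r ler_nat.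
    by case: (b j _) => //=; case cj: (c j w) => //; rewrite (cS _ _ cj).
  rewrite !mul1r -natrD ler_nat; case: (H w) Hj0 => [/(_ isT)[/negPf-> ->]//|_].
  by case cj: (c j0 w) => //; rewrite (cS _ _ cj).
have {Hsum} : pr P H <= m%:R^-1 * \sum_(j < m) (pr P (c j.+2) - pr P (c j)).
  move: Hsum; rewrite big_sumType /= big_const card_unit /= addr0 mul1r.
  rewrite -lerBrDr -sumrB mulr_sumr => /le_trans; apply; apply: ler_sum => j _.
  by rewrite !mul1r !prbc mulrBr.
rewrite [X in _ <= X -> _]mulrC => /le_trans; apply; rewrite ler_pM2r ?invr_gt0 //.
(* The increments have step two, so [f] adds two consecutive terms; telescoping leaves [f m - f 0],
   which is at most 2. *)
pose f j := pr P (c j) + pr P (c j.+1).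
rewrite -(big_mkord xpredT (fun j => pr P (c j.+2) - pr P (c j))).
rewrite (eq_bigr (fun j => f j.+1 - f j)) => [|j _]; last by rewrite /f; ring.
rewrite telescope_sumr //.
have C0 j : 0 <= pr P (c j) by exact: pr_ge0.
have C1 j : pr P (c j) <= 1 by exact: pr_le1.
rewrite /f; move: (C0 0%N) (C0 1%N) (C1 m) (C1 m.+1); lra.
Qed.

(** The ends of an edge outside [M] are joined at its own label. Either they are joined already
    [1/m] lower, which makes the edge unlikely in [W], or the label is critical. *)
Lemma pr_wst_notin_mst e (m : nat) : (0 < m)%N ->
  pr P (fun w => (e \in W w) && (e \notin M w)) <=
  2 / m%:R + #|{: edge n}|%:R * expR (- beta / m%:R).
Proof.
move=> m0; have mR0 : 0 < m%:R^-1 :> R by rewrite invr_gt0 ltr0n.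
apply: le_trans (lerD (pr_critical e m0) (wst_excess e mR0)).
pose q (b : bool) w := if b then joined (below (U^~ w) e (U e w)) e &&
    ~~ joined (below (U^~ w) e (U e w - m%:R^-1)) e
  else (e \in W w) && joined (below (U^~ w) e (U e w - m%:R^-1)) e.
have := @ae_pr_le_sum _ _ _ P bool
  (fun w => (e \in W w) && (e \notin M w)) (fun=> 1) q.
rewrite big_bool /= !mul1r; apply => //.
- exact: (mMW (fun A B => (e \in B) && (e \notin A))).
- case=> /=; apply: measurableIb.
  + exact: measurable_joined_self.
  + by apply: measurableNb; exact: (measurable_joined_excess e _ true).
  + exact: (mMW (fun _ A => e \in A)).
  + exact: (measurable_joined_excess e _ true).
- apply: filterS (cpl_M_mst cpl) => w mstM /andP[eW eM].
  rewrite big_bool /= !mul1r (joined_below_mst mstM eM) eW /=.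
  by case: joined => /=; rewrite ?addr0 ?add0r.
Qed.

(** An edge of label at most [q] whose ends are not joined by other edges at level [q] must lie in
    [M], and these two conditions are independent. *)
Lemma pr_unjoined e q : 0 <= q <= 1 ->
  q * pr P (fun w => ~~ joined (below (U^~ w) e q) e) <= pr P (fun w => e \in M w).
Proof.
move=> q01; rewrite -[X in X * _](uniform_le (cpl_U_uniform cpl e) q01).
have mle : measurable [set x : R | x <= q].
  by rewrite (_ : [set x | _] = `]-oo, q]%classic).
rewrite -(independent_below (cpl_U_independent cpl) e q
  (fun A => ~~ joined A e) mle).
apply: ae_pr_le; last first.
- apply: filterS (cpl_M_mst cpl) => w mstM /andP[Uq]; apply: contraR => eM.
  by apply: joinedS (joined_below_mst mstM eM); exact: belowS.
- exact: (mM (fun A => e \in A)).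
- apply: measurableIb => //; apply: measurableNb.
  exact: (measurable_joined_below e q true).
Qed.

Lemma sum_pr_mst : \sum_e pr P (fun w => e \in M w) <= n%:R.
Proof.
have mT : measurable [set _ : T | true].
  by rewrite (_ : [set _ | _] = setT) //; apply/seteqP; split.
have : \sum_e 1 * pr P (fun w => e \in M w) <=
    \sum_(i : unit) n%:R * pr P (fun=> true).
  apply: ae_sum_pr_le => //.
  - by move=> e; exact: (mM (fun A => e \in A)).
  - apply: filterS (cpl_M_mst cpl) => w [treeM _].
    rewrite big_const card_unit /= addr0 mulr1.
    under eq_bigr do rewrite mul1r.
    rewrite -natr_sum ler_nat -big_mkcond /= sum1_card.
    (* All edges of [M] are removed at once; [o w] serves as the base vertex, and at most [n]
       vertices can be cut off from it. *)
    apply: leq_trans (card_tree_disconnected (o w) treeM (fintype.subxx _)) _.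
    by rewrite -[leqRHS]card_ord max_card.
under eq_bigr do rewrite mul1r.
move=> /le_trans; apply; rewrite big_const card_unit /= addr0.
by rewrite -[leRHS]mulr1 ler_wpM2l // pr_le1.
Qed.

Let measurable_heavy e q : measurable [set w | (e \in M w) && (q < U e w)].
Proof.
apply: measurableIb; first exact: (mM (fun A => e \in A)).
rewrite (_ : [set w | _] = ~` [set w | U e w <= q]); first exact: measurableC.
by apply/seteqP; split=> w /=; rewrite ltNge => /negP.
Qed.

(** By [card_heavy] in expectation and then [pr_unjoined], [n * q] times the sum is at most 4 times
    the expected number of tree edges, hence at most [4 * n]. *)
Lemma sum_pr_heavy q : (0 < n)%N -> 0 <= q <= 1 ->
  q * \sum_e pr P (fun w => (e \in M w) && (q < U e w)) <= 4.
Proof.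
move=> n0 q01; have nR0 : 0 < n%:R :> R by rewrite ltr0n.
have heavy : \sum_e n%:R * pr P (fun w => (e \in M w) && (q < U e w)) <=
    \sum_e 4 * pr P (fun w => ~~ joined (below (U^~ w) e q) e).
  apply: ae_sum_pr_le => //.
  - by move=> e; apply: measurableNb; exact: (measurable_joined_below e q true).
  - apply: filterS (cpl_M_mst cpl) => w mstM.
    have := card_heavy q mstM; rewrite -(ler_nat R) !natrM.
    rewrite -!mulr_sumr -!natr_sum -!sum1_card [X in _ * X%:R <= _]big_mkcond.
    rewrite [X in _ <= _ * X%:R -> _]big_mkcond /=.
    under eq_bigr do rewrite inE.
    by under [X in _ <= _ * X%:R -> _]eq_bigr do rewrite inE.
rewrite -(ler_pM2l nR0) mulrCA mulr_sumr.
apply: le_trans (ler_wpM2l (proj1 (andP q01)) heavy) _.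
rewrite -mulr_sumr mulrCA [leRHS]mulrC ler_wpM2l // mulr_sumr.
by apply: le_trans sum_pr_mst; apply: ler_sum => e _; exact: pr_unjoined.
Qed.

Let measurable_tadj q x y : measurable [set w | tadj [set g | U g w <= q]%SET x y].
Proof.
apply: (@measurable_finset_valued _ _ _ (fun w => [set g | U g w <= q]%SET)
  (fun A => tadj A x y)) => g.
rewrite (_ : [set w | _] = [set w | U g w <= q]) //.
by apply/seteqP; split=> w /=; rewrite inE.
Qed.

Lemma sum_pr_tadj2 q : 0 <= q <= 1 ->
  \sum_x \sum_y \sum_z pr P (fun w => tadj [set g | U g w <= q]%SET x y &&
    tadj [set g | U g w <= q]%SET x z) <= n%:R * (n%:R * (q + n%:R * q ^+ 2)).
Proof.
move=> q01; have /andP[q0 q1] := q01.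
have mle : measurable [set x : R | x <= q].
  by rewrite (_ : [set x | _] = `]-oo, q]%classic).
have edgeP x y : (exists e : edge n, val e = [set x; y]%SET) \/
    forall A : {set edge n}, tadj A x y = false.
  have [[e eP]|noe] := pselect (exists e : edge n, val e = [set x; y]%SET).
    by left; exists e.
  right=> A; apply/negbTE/negP => /exists_inP[e _ /eqP exy].
    by apply: noe; exists e.
have sum_le (F : 'I_n -> R) (a : R) : (forall i, F i <= a) -> \sum_i F i <= n%:R * a.
  move=> Fa; apply: (le_trans (ler_sum _ (fun i _ => Fa i))).
  by rewrite sumr_const card_ord mulr_natl lexx.
apply: (sum_le _ _) => x; apply: (sum_le _ _) => y.
(* For [z = y] both conditions concern the same label and have probability [q]; for [z != y] they
   concern two independent labels. A pair of vertices that is not an edge contributes 0. *)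
apply: (@le_trans _ _ (\sum_(z < n) (q *+ (z == y) + q ^+ 2))).
  apply: ler_sum => z _.
  have [[e exy]|no] := edgeP x y; last first.
    rewrite (_ : (fun w => _) = xpred0) ?pr0 ?addr_ge0 ?mulrn_wge0 ?sqr_ge0 //.
    by apply/funext => w; rewrite no.
  have [[f fxz]|no] := edgeP x z; last first.
    rewrite (_ : (fun w => _) = xpred0) ?pr0 ?addr_ge0 ?mulrn_wge0 ?sqr_ge0 //.
    by apply/funext => w; rewrite no andbF.
  have tE : (fun w => tadj [set g | U g w <= q]%SET x y &&
      tadj [set g | U g w <= q]%SET x z) = (fun w => (U e w <= q) && (U f w <= q)).
    by apply/funext => w; rewrite (tadj_edge _ exy) (tadj_edge _ fxz) !inE.
  rewrite tE; have [zy|zy] := eqVneq z y.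
    have <- : e = f by apply: val_inj; rewrite exy fxz zy.
    under [X in pr P X]eq_fun do rewrite andbb.
    by rewrite (uniform_le (cpl_U_uniform cpl e)) // lerDl sqr_ge0.
  rewrite (independent_pair (cpl_U_independent cpl) (b := fun x => x <= q)) //.
    by rewrite !(uniform_le (cpl_U_uniform cpl _)) // add0r expr2.
  apply: contraNneq zy => ef; move: fxz; rewrite -ef exy => xyz.
  have : z \in [set x; y]%SET by rewrite xyz set22.
  have : y \in [set x; z]%SET by rewrite -xyz set22.
  rewrite !inE => /orP[/eqP yx|/eqP yz _]; last by rewrite yz.
  by case/orP=> /eqP ->; rewrite yx.
rewrite big_split /= sumr_const card_ord mulr_natl lerD2r.
by rewrite (bigD1 y) //= eqxx big1 ?addr0 // => z /negPf ->.
Qed.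

Local Notation bad k w := (discrepancy_nbhd (M w) (W w) k).

Let measurable_bad k v : measurable [set w | v \in bad k w].
Proof. exact: (mMW (fun A B => v \in discrepancy_nbhd A B k)). Qed.

Lemma sum_pr_bad0 (m : nat) : (0 < m)%N ->
  \sum_v pr P (fun w => v \in bad 0 w) <=
  8 * n%:R ^+ 2 * (2 / m%:R + n%:R ^+ 2 * expR (- beta / m%:R)).
Proof.
move=> m0.
have disc : \sum_v 1 * pr P (fun w => v \in bad 0 w) <=
    \sum_e 8 * pr P (fun w => (e \in W w) && (e \notin M w)).
  apply: ae_sum_pr_le => //.
  - by move=> e; exact: (mMW (fun A B => (e \in B) && (e \notin A))).
  - apply: filterS2 (cpl_M_mst cpl) (cpl_W_tree cpl) => w [treeM _] treeW.
    have := card_discrepancy treeM treeW; rewrite -(ler_nat R) natrM.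
    rewrite -!mulr_sumr -!natr_sum -!sum1_card [X in X%:R <= _]big_mkcond.
    rewrite [X in _ <= _ * X%:R -> _]big_mkcond /= mul1r.
    by under [X in _ <= _ * X%:R -> _]eq_bigr do rewrite inE andbC.
move: disc; rewrite -!mulr_sumr mul1r => /le_trans; apply.
rewrite -mulrA ler_pM2l // -natrX.
apply: (le_trans (ler_sum _ (fun e _ => pr_wst_notin_mst e m0))).
set c := expR _; have c0 : 0 <= c by exact: expR_ge0.
have edges : #|{: edge n}|%:R <= (n ^ 2)%:R :> R by rewrite ler_nat card_edge.
have m20 : 0 <= 2 / m%:R :> R by rewrite divr_ge0.
rewrite sumr_const -[X in X <= _]mulr_natl.
apply: (@le_trans _ _ (#|{: edge n}|%:R * (2 / m%:R + (n ^ 2)%:R * c))).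
  by rewrite ler_wpM2l // lerD2l ler_wpM2r.
by rewrite ler_wpM2r // addr_ge0 // mulr_ge0.
Qed.

(** This is [card_nbhd] in expectation, with one index type gathering its three kinds of terms. *)
Lemma sum_pr_badS (K q : R) k : 0 < K ->
  \sum_v pr P (fun w => v \in bad k.+1 w) <=
  (1 + K) * \sum_v pr P (fun w => v \in bad k w) +
  K^-1 * (\sum_x \sum_y \sum_z pr P (fun w => tadj [set g | U g w <= q]%SET x y &&
    tadj [set g | U g w <= q]%SET x z)) +
  4 * \sum_e pr P (fun w => (e \in M w) && (q < U e w)).
Proof.
move=> K0.
pose b (j : 'I_n + ('I_n * ('I_n * 'I_n) + edge n)) : R :=
  match j with inl _ => 1 + K | inr (inl _) => K^-1 | inr (inr _) => 4 end.
pose p j w := match j with inl v => v \in bad k w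
  | inr (inl t) => tadj [set g | U g w <= q]%SET t.1 t.2.1 &&
      tadj [set g | U g w <= q]%SET t.1 t.2.2
  | inr (inr e) => (e \in M w) && (q < U e w) end.
have : \sum_v 1 * pr P (fun w => v \in bad k.+1 w) <= \sum_j b j * pr P (p j).
  apply: ae_sum_pr_le => //.
  - by case=> [_|[_|_]] //=; rewrite ?invr_ge0 ?addr_ge0 ?ltW.
  - move=> [v|[t|e]]; [exact: measurable_bad| |exact: measurable_heavy].
    by apply: measurableIb; exact: measurable_tadj.
  - apply/aeW => w; have := card_nbhd (U^~ w) (M w) q (bad k w) K0.
    rewrite !big_sumType /= -!mulr_sumr mul1r.
    rewrite (_ : #|[set g in M w | q < U g w]%SET|%:R =
        \sum_e ((e \in M w) && (q < U e w))%:R).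
      by rewrite !card_sum_in sum_triple addrA.
    by rewrite card_sum_in; apply: eq_bigr => e _; rewrite inE.
rewrite -mulr_sumr mul1r => /le_trans; apply.
by rewrite !big_sumType /= -!mulr_sumr sum_triple addrA.
Qed.

(** Split by the value of the root, which is uniform and independent of the pair of trees. *)
Lemma pr_root_bad k :
  pr P (fun w => o w \in bad k w) = n%:R^-1 * \sum_v pr P (fun w => v \in bad k w).
Proof.
have mo v : measurable [set w | o w == v].
  exact: (measurable_discrete (fun x => x == v) (cpl_o_measurable cpl)).
rewrite mulr_sumr (@pr_sum _ _ _ P _ _ (fun v w => (v \in bad k w) && (o w == v))).
- apply: eq_bigr => v _; apply: EFin_inj; rewrite mulrC EFinM !prE //; last first.
    exact: measurableIb.
  rewrite -(cpl_o_uniform cpl v) -(cpl_o_independent cpl).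
  + by congr (P _); apply/seteqP; split=> w /=; [case/andP=> ? /eqP|case=> -> /eqP].
  + pose G := rv_system U `|` discrete_system M `|` discrete_system W.
    apply: (@measurable_discrete2 _ (g_sigma_algebraType G) _ _ M W
      (fun A B => v \in discrepancy_nbhd A B k)) => A DA.
      by apply: sub_sigma_algebra; left; right.
    by apply: sub_sigma_algebra; right.
  + by exists [set v] => //; rewrite setTI.
- rewrite (_ : [set w | _] = \bigcup_(v in setT) [set w | (v \in bad k w) && (o w == v)]).
    apply: fin_bigcup_measurable => [|v _]; first exact: finite_finset.
    exact: measurableIb.
  by apply/seteqP; split=> w /=; [exists (o w) => //=; rewrite eqxx andbT
    |case=> v _ /= /andP[vb /eqP->]].
- by move=> v; exact: measurableIb.
- move=> w; rewrite (bigD1 (o w)) //= eqxx andbT big1 ?addn0 // => v.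
  by rewrite eq_sym => /negPf ->; rewrite andbF.
Qed.

Lemma pr_root_bad0_le : (1 < n)%N -> 0 < beta -> 8 * ln n%:R <= beta ->
  pr P (fun w => o w \in bad 0 w) <= 128 * (n%:R * ln n%:R / beta) + 8 / n%:R.
Proof.
move=> n1 beta0 beta8.
have nR1 : 1 < n%:R :> R by rewrite ltr1n.
have nR0 : 0 < n%:R :> R by rewrite (lt_trans ltr01).
have ln0 : 0 < ln n%:R :> R by rewrite ln_gt0.
(* For [m] the integer part of [t], [beta / m >= 4 * ln n], so the exponential is at most [n ^ -4],
   which beats the number of candidate edges in the swap. Since [t >= 2], rounding loses at most a
   factor 2. *)
pose t := beta / (4 * ln n%:R).
have l40 : 0 < 4 * ln n%:R :> R by rewrite mulr_gt0.
have t2 : 2 <= t by rewrite /t ler_pdivlMr // mulrA; apply: le_trans beta8; lra.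
pose m := Num.truncn t.
have t0 : 0 <= t by lra.
have /andP[mt tm] : m%:R <= t < m.+1%:R by exact: truncn_itv.
have tm2 : t <= 2 * m%:R by move: tm; rewrite -natr1; lra.
have mR0 : 0 < m%:R :> R by lra.
have m0 : (0 < m)%N by rewrite -(ltr_nat R).
rewrite pr_root_bad; apply: le_trans (ler_wpM2l _ (sum_pr_bad0 m0)) _.
  by rewrite invr_ge0 ltW.
have exp_le : expR (- beta / m%:R) <= (n%:R ^+ 4)^-1.
  rewrite -[n%:R ^+ 4]lnK ?posrE ?exprn_gt0 // -expRN ler_expR lnXn // mulNr lerN2.
  rewrite ler_pdivlMr //; move: mt; rewrite /t ler_pdivlMr //.
  by congr (_ <= _); rewrite -mulr_natl; ring.
have inv_le : 2 / m%:R <= 16 * (ln n%:R / beta).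
  have -> : 16 * (ln n%:R / beta) = 4 / t by rewrite /t; field; rewrite !gt_eqF.
  by rewrite ler_pdivrMr // mulrAC ler_pdivlMr; lra.
have -> : 128 * (n%:R * ln n%:R / beta) + 8 / n%:R = n%:R^-1 * (8 * n%:R ^+ 2 *
    (16 * (ln n%:R / beta) + n%:R ^+ 2 * (n%:R ^+ 4)^-1)) :> R.
  by field; rewrite !gt_eqF.
rewrite ler_pM2l ?invr_gt0 // ler_pM2l ?mulr_gt0 ?exprn_gt0 // lerD //.
by rewrite ler_pM2l ?exprn_gt0.
Qed.

(** The level is [q = L / n], at most 1 since [L <= n]. Per vertex, the second moment of the light
    degrees is then at most [n * (q + n * q ^ 2) = L + L ^ 2], and the heavy edges cost [16 / L]. *)
Lemma pr_root_badS_le (K L : R) k : 0 < K -> 0 < L -> L <= n%:R ->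
  pr P (fun w => o w \in bad k.+1 w) <=
  (1 + K) * pr P (fun w => o w \in bad k w) + K^-1 * (L + L ^+ 2) + 16 / L.
Proof.
move=> K0 L0 Ln; have nR0 : 0 < n%:R :> R by exact: lt_le_trans Ln.
have n0 : (0 < n)%N by rewrite -(ltr_nat R).
pose q := L / n%:R; have q0 : 0 < q by rewrite divr_gt0.
have q01 : 0 <= q <= 1 by rewrite ltW //= /q ler_pdivrMr // mul1r.
rewrite !pr_root_bad.
have := sum_pr_badS q k K0; have := sum_pr_tadj2 q01; have := sum_pr_heavy n0 q01.
set D := \sum_e _; set X := \sum_x _; set B' := \sum_v _; set B := \sum_v _.
move=> Dle Xle Ble.
apply: (@le_trans _ _ (n%:R^-1 * ((1 + K) * B + K^-1 * (n%:R * (n%:R * (q + n%:R * q ^+ 2)))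
   + 4 * (4 / q)))).
  rewrite ler_pM2l ?invr_gt0 //; apply: (le_trans Ble).
  rewrite lerD //.
    by rewrite lerD2l ler_pM2l ?invr_gt0.
  by rewrite ler_pM2l // ler_pdivlMr // mulrC.
have -> // : n%:R^-1 * ((1 + K) * B + K^-1 * (n%:R * (n%:R * (q + n%:R * q ^+ 2))) +
    4 * (4 / q)) = (1 + K) * (n%:R^-1 * B) + K^-1 * (L + L ^+ 2) + 16 / L.
by rewrite /q; field; rewrite !gt_eqF.
Qed.

Lemma measurable_coupling (Q : {set edge n} -> {set edge n} -> 'I_n -> Prop) :
  measurable [set w | Q (M w) (W w) (o w)].
Proof.
apply: (measurable_discrete (fun x => Q x.1.1 x.1.2 x.2)
  (discrete_system_pair (discrete_system_pair _ _) _)).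
- exact: cpl_M_measurable cpl.
- exact: cpl_W_measurable cpl.
- exact: cpl_o_measurable cpl.
Qed.

Let measurable_root_bad k : measurable [set w | o w \in bad k w].
Proof.
exact: (measurable_coupling (fun A B x => x \in discrepancy_nbhd A B k)).
Qed.

Lemma P_subset_bad (A B : set T) k : measurable A -> measurable B ->
  (forall w, A w -> o w \notin bad k w -> B w) ->
  (P A <= P B + (pr P (fun w => o w \in bad k w))%:E)%E.
Proof.
move=> mA mB AB; rewrite prE //; apply: le_trans (measureU2 _ mB _); last by [].
apply: le_measure; rewrite ?inE //; first exact: measurableU.
by move=> w Aw /=; case: (boolP (o w \in bad k w)) => [|/(AB w Aw)]; [right|left].
Qed.

End coupling.

(** * Passage to the limit *)

Section limits.
Variable R : realType.

(** The order of choices matters: [L] makes [16 / L] small, then [K] dominates [L + L ^ 2], and only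
    then a large [n] makes [(1 + K) * s k n] small. *)
Lemma cvg0_recursive (s : nat -> nat -> R) :
  (forall k n, 0 <= s k n) -> s 0%N n @[n --> \oo] --> (0 : R) ->
  (forall k n (K L : R), 0 < K -> 0 < L -> L <= n.+1%:R ->
    s k.+1 n <= (1 + K) * s k n + K^-1 * (L + L ^+ 2) + 16 / L) ->
  forall k, s k n @[n --> \oo] --> (0 : R).
Proof.
move=> s_ge0 s00 sS; elim=> // k IHk; apply/cvgr0Pnorm_le => e e0.
(* These values make each of the last two terms equal to [e / 3]. *)
pose L := 48 / e; pose K := 3 * (L + L ^+ 2) / e.
have L0 : 0 < L by rewrite divr_gt0.
have LL0 : 0 < L + L ^+ 2 by rewrite addr_gt0 // exprn_gt0.
have K0 : 0 < K by rewrite divr_gt0 // mulr_gt0.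
have eK0 : 0 < e / (3 * (1 + K)) by rewrite divr_gt0 // mulr_gt0 // addr_gt0.
move/cvgr0Pnorm_le : IHk => /(_ _ eK0) IHk.
near=> n; rewrite ger0_norm //.
have Ln : L <= n.+1%:R.
  by apply: (@le_trans _ _ n%:R); [near: n; exact: nbhs_infty_ger|rewrite ler_nat].
apply: (le_trans (sS k n K L K0 L0 Ln)).
have -> : K^-1 * (L + L ^+ 2) = e / 3.
  by rewrite /K; move: LL0; set X := L + _ => X0; field; rewrite !gt_eqF.
have -> : 16 / L = e / 3 by rewrite /L; field; rewrite gt_eqF.
have : (1 + K) * s k n <= e / 3.
  rewrite mulrC -ler_pdivlMr ?addr_gt0 //.
  have -> : e / 3 / (1 + K) = e / (3 * (1 + K)).
    by field; rewrite gt_eqF // addr_gt0.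
  rewrite -[leLHS]ger0_norm //; near: n; exact: IHk.
lra.
Unshelve. all: by end_near. Qed.

(** The difference of the finite parts is squeezed between [- s] and [s]. *)
Lemma cvge_close (a b : nat -> \bar R) (s : nat -> R) (l : \bar R) :
  (forall n, a n \is a fin_num) -> (forall n, b n \is a fin_num) ->
  (forall n, a n <= b n + (s n)%:E)%E -> (forall n, b n <= a n + (s n)%:E)%E ->
  s n @[n --> \oo] --> (0 : R) -> a n @[n --> \oo] --> l -> b n @[n --> \oo] --> l.
Proof.
move=> afin bfin ab ba s0 al.
have d0 : (fine (b n) - fine (a n)) @[n --> \oo] --> (0 : R).
  apply: (@squeeze_cvgr _ _ _ _ (fun n => - s n) s) => //; last first.
    by rewrite -oppr0; exact: cvgN.
  apply: nearW => n; move: (ab n) (ba n).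
  rewrite -(fineK (afin n)) -(fineK (bfin n)) -!EFinD !lee_fin => ? ?.
  by apply/andP; split; lra.
have dE : (fine (b n) - fine (a n))%:E @[n --> \oo] --> (0 : R)%:E.
  by apply: cvg_EFin; [exact: nearW|exact: d0].
rewrite -[l]adde0; rewrite (_ : b = a \+ (fun n => (fine (b n) - fine (a n))%:E))%E.
  by apply: cvgeD => //; rewrite fin_num_adde_defl.
by apply/funext => n; rewrite /= EFinB !fineK // [RHS]addeC subeK.
Qed.

End limits.

(* The complete graph K_N is indexed by n with N = n.+1, so that it has a vertex. *)
Theorem theorem1p9 (R : realType) (beta : nat -> R)
    (d : nat -> measure_display) (Omega : forall n, measurableType (d n))
    (P : forall n, probability (Omega n) R)
    (U : forall n, edge n.+1 -> {RV (P n) >-> R})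
    (M W : forall n, Omega n -> {set edge n.+1})
    (o : forall n, Omega n -> 'I_n.+1)
    (beta_ge0 : forall n, 0 <= beta n)
    (beta_large : much_greater beta (fun n => n%:R * ln n%:R))
    (coupling : forall n,
      mst_wst_coupling (beta n.+1) (U n) (M n) (W n) (o n)) :
  (forall (r : nat) (Y : forall n, Omega n -> R),
     (forall n, is_cond_prob (P n) <<s rv_system (U n) >>
        [set w | rooted_ball r (rooted_tree (M n w) (o n w)) =
                 rooted_ball r (rooted_tree (W n w) (o n w))] (Y n)) ->
     'E_(P n)[Y n]%E @[n --> \oo] --> 1%E) /\
  (forall (d' : measure_display) (Omega' : measurableType d')
      (P' : probability Omega' R) (G : Omega' -> rooted_graph nat),
     random_rooted_graph G ->
     (local_limit P (fun n w => rooted_tree (M n w) (o n w)) P' G <->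
      local_limit P (fun n w => rooted_tree (W n w) (o n w)) P' G)).
Proof.
pose s k n := pr (P n) (fun w => o n w \in discrepancy_nbhd (M n w) (W n w) k).
have s_cvg k : s k n @[n --> \oo] --> (0 : R).
  apply: cvg0_recursive k => [k n||k n K L K0 L0 Ln]; first exact: pr_ge0.
    have [betaN0 betaN] := beta_large.
    have ratio : (n.+1%:R * ln n.+1%:R / beta n.+1) @[n --> \oo] --> (0 : R).
      by rewrite (cvg_shiftS (fun n => n%:R * ln n%:R / beta n)).
    (* The threshold [8^-1] gives [8 * ln N <= beta N] for [N = n.+1], as [pr_root_bad0_le]
       requires. *)
    have ratio1 : \forall n \near \oo, n.+1%:R * ln n.+1%:R / beta n.+1 <= 8^-1.
      by apply: cvgr_le ratio _ _; rewrite invr_gt0.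
    have betaN0S : \forall n \near \oo, beta n.+1 != 0.
      by have [N _ NP] := betaN0; exists N => // n /= Nn; apply: NP => /=; exact: leqW.
    apply: (@squeeze_cvgr _ _ _ _ (fun=> 0)
      (fun n => 128 * (n.+1%:R * ln n.+1%:R / beta n.+1) + 8 / n.+1%:R)).
    - near=> n; rewrite pr_ge0 /=.
      have beta0 : 0 < beta n.+1.
        by rewrite lt_neqAle beta_ge0 eq_sym andbT; near: n.
      have n1 : (1 < n.+1)%N by rewrite ltnS; near: n; exact: nbhs_infty_ge.
      apply: (pr_root_bad0_le (beta_ge0 _) (coupling n)) => //.
      have ln0 : 0 <= ln n.+1%:R :> R by rewrite ln_ge0 // ler1n.
      have : n.+1%:R * ln n.+1%:R / beta n.+1 <= 8^-1 by near: n.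
      rewrite ler_pdivrMr // -ler_pdivrMl ?invr_gt0 // invrK; apply: le_trans.
      by rewrite ler_wpM2l // ler_peMl // ler1n.
    - exact: cvg_cst.
    - rewrite (_ : 0 = 128 * 0 + 8 * 0 :> R); last by rewrite !mulr0 addr0.
      apply: cvgD; apply: cvgM; [exact: cvg_cst|exact: ratio|exact: cvg_cst|].
      exact: cvg_harmonic.
  exact: (pr_root_badS_le (coupling n)).
have agree r n w : o n w \notin discrepancy_nbhd (M n w) (W n w) r ->
    rooted_ball r (rooted_tree (M n w) (o n w)) =
    rooted_ball r (rooted_tree (W n w) (o n w)).
  exact: rooted_ball_discrepancy.
split=> [r Y condY|d' Omega' P' G _].
  pose E n := [set w | rooted_ball r (rooted_tree (M n w) (o n w)) =
                       rooted_ball r (rooted_tree (W n w) (o n w))].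
  have mE n : measurable (E n).
    exact: (measurable_coupling (coupling n) (fun A B x =>
      rooted_ball r (rooted_tree A x) = rooted_ball r (rooted_tree B x))).
  (* Integrating any version of the conditional probability over the whole space gives the
     probability of the event. *)
  have EY n : ('E_(P n)[Y n] = P n (E n))%E.
    have sT := @measurableT _ (g_sigma_algebraType (rv_system (U n))).
    by have [_ _ /(_ _ sT)] := condY n; rewrite setTI unlock.
  under eq_fun do rewrite EY.
  apply: (@cvge_close R (fun=> 1%E) _ (s r)) => //; last exact: cvg_cst.
  - by move=> n; exact: fin_num_measure.
  - move=> n; rewrite -(probability_setT (P n)).
    by apply: (P_subset_bad (coupling n)) => // w _; exact: agree.
  - move=> n; rewrite -[leLHS]adde0; apply: leeD; first exact: probability_le1.
    by rewrite lee_fin pr_ge0.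
have mball n r k (H : rooted_graph 'I_k) :
    measurable [set w | rooted_iso (rooted_ball r (rooted_tree (M n w) (o n w))) H] /\
    measurable [set w | rooted_iso (rooted_ball r (rooted_tree (W n w) (o n w))) H].
  split.
    exact: (measurable_coupling (coupling n) (fun A B x =>
      rooted_iso (rooted_ball r (rooted_tree A x)) H)).
  exact: (measurable_coupling (coupling n) (fun A B x =>
    rooted_iso (rooted_ball r (rooted_tree B x)) H)).
(* Off the bad event the two balls coincide, so their class probabilities differ by at most [s r n],
   and a limit of one is a limit of the other. *)
split=> lim r k H; apply: (cvge_close _ _ _ _ (s_cvg r)) (lim r k H) => n;
  have [mMH mWH] := mball n r k H; rewrite ?fin_num_measure //;
  by apply: (P_subset_bad (coupling n)) => // w /= + /agree E; rewrite E.
Unshelve. all: by end_near. Qed.
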